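(* Let $p$ be a prime, $N\in\mathbb Z$, $\alpha>0$. The operator $D^\alpha_N$ maps $\mathcal D(B_N)$ into $\mathcal D(B_N)$ and, for each $\varphi\in\mathcal D(B_N)$, admits the following representations. (i) $D^\alpha_N\varphi=f^{(N)}_{-\alpha}*\varphi$, where the convolution is understood in the sense of the additive group of $B_N$. (ii) For all $x\in B_N$, $$\left(D^\alpha_N\varphi\right)(x)=\lambda\varphi(x)+\frac{1-p^\alpha}{1-p^{-\alpha-1}}\int_{B_N}|y|_p^{-\alpha-1}\left[\varphi(x-y)-\varphi(x)\right]dy.$$ (iii) On $\mathcal D(B_N)$, the operator $D^\alpha_N-\lambda I$ coincides with the pseudo-differential operator $\varphi\mapsto\mathcal F_N^{-1}\left(P_{N,\alpha}\,\mathcal F_N\varphi\right)$, where $$P_{N,\alpha}(\xi)=\frac{1-p^\alpha}{1-p^{-\alpha-1}}\int_{B_N}|y|_p^{-\alpha-1}\left[\chi(y\xi)-1\right]dy .$$ This symbol, given for $\xi\in(\mathbb Q_p\setminus B_{-N})\cup\{0\}$, extends uniquely to a function on $\mathbb Q_p/B_{-N}$ (that is, its value depends only on the coset $\xi+B_{-N}$).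
   Context: $\mathbb Q_p$ is the field of $p$-adic numbers with absolute value $|\cdot|_p$, and $dx$ is the Haar measure on its additive group with $\int_{\mathbb Z_p}dx=1$. $\chi(x)=\exp(2\pi i\{x\}_p)$, with $\{x\}_p$ the $p$-adic fractional part, is the standard additive character of $\mathbb Q_p$ (trivial on $\mathbb Z_p$). For $N\in\mathbb Z$, $B_N=\{x\in\mathbb Q_p:\ |x|_p\le p^N\}$, a compact open additive subgroup. $\mathcal D(\mathbb Q_p)$ is the space of complex-valued locally constant compactly supported functions on $\mathbb Q_p$; $\mathcal D(B_N)$ is the space of locally constant functions on $B_N$, identified (via extension by zero) with the functions in $\mathcal D(\mathbb Q_p)$ supported in $B_N$. $\mathcal D'(B_N)$ is the dual space of distributions. Vladimirov's operator: for $u\in\mathcal D(\mathbb Q_p)$, $D^\alpha u=\mathcal F^{-1}\left[|\xi|_p^\alpha\,\mathcal Fu\right]$, where $(\mathcal Fu)(\xi)=\int_{\mathbb Q_p}\chi(x\xi)u(x)\,dx$; equivalently $$(D^\alpha u)(x)=\frac{1-p^\alpha}{1-p^{-\alpha-1}}\int_{\mathbb Q_p}|y|_p^{-\alpha-1}[u(x-y)-u(x)]\,dy.$$ The operator $D^\alpha_N$ on $\mathcal D(B_N)$: extend $\varphi\in\mathcal D(B_N)$ by zero to $\mathbb Q_p$, apply $D^\alpha$, and restrict the result to $B_N$. $\lambda=\dfrac{p-1}{p^{\alpha+1}-1}\,p^{\alpha(1-N)}$. The distribution $f^{(N)}_{-\alpha}\in\mathcal D'(B_N)$ is defined by $$\left\langle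 f^{(N)}_{-\alpha},\varphi\right\rangle=\lambda\varphi(0)+\frac{1-p^\alpha}{1-p^{-\alpha-1}}\int_{B_N}[\varphi(x)-\varphi(0)]\,|x|_p^{-\alpha-1}dx,\qquad\varphi\in\mathcal D(B_N).$$ For $f\in\mathcal D'(B_N)$ and $\varphi\in\mathcal D(B_N)$, the convolution on the group $B_N$ is $(f*\varphi)(x)=\langle f,\varphi(x-\cdot)\rangle$, $x\in B_N$. The dual group of $B_N$ is identified with the discrete group $\mathbb Q_p/B_{-N}$, the coset $\xi+B_{-N}$ corresponding to the character $x\mapsto\chi(\xi x)$ of $B_N$. The Fourier transform on $B_N$ is $$(\mathcal F_N\varphi)(\xi)=p^{-N}\int_{B_N}\chi(x\xi)\varphi(x)\,dx,$$ viewed as a function on $\mathbb Q_p/B_{-N}$ (cosets represented by $\xi\in(\mathbb Q_p\setminus B_{-N})\cup\{0\}$). It is a bijection of $\mathcal D(B_N)$ onto the finitely supported functions on $\mathbb Q_p/B_{-N}$; $\mathcal F_N^{-1}$ is its inverse. *)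

(* Defs.v *)
From HB Require Import structures.
From mathcomp Require Import all_boot all_order all_algebra.
From mathcomp Require Import fraction ring_quotient generic_quotient.
From mathcomp Require Import all_classical all_reals all_analysis.
From mathcomp Require Import complex.
From mathcomp Require Import zify.
Set Implicit Arguments.
Unset Strict Implicit.
Unset Printing Implicit Defensive.
Import Order.TTheory GRing.Theory Num.Theory.
Local Open Scope classical_set_scope.
Local Open Scope ring_scope.

Section PadicIntegers.
Variables (p : nat) (p_pr : prime p).

Definition coherent (z : nat -> nat) : bool :=
  `[< forall n, z n = (z n.+1 %% p ^ n)%N >].

(* Z_p as the inverse limit of the Z/p^n: [pint_val z n] is the representative
   in [0, p^n) of the class of z modulo p^n.  The phantom argument records that
   p is prime, which the ring structures below need. *)
Record padic_int (p_pr : prime p) := PadicInt {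
  pint_val :> nat -> nat;
  pint_coherent : coherent pint_val }.

HB.instance Definition _ := [isSub for @pint_val p_pr].
HB.instance Definition _ := [Choice of padic_int p_pr by <:].

Local Notation Zp := (padic_int p_pr).
Implicit Types x y z : Zp.

Let p_gt0 : (0 < p)%N. Proof. exact: prime_gt0. Qed.
Let p_gt1 : (1 < p)%N. Proof. exact: prime_gt1. Qed.
Let pX_gt0 n : (0 < p ^ n)%N. Proof. by rewrite expn_gt0 p_gt0. Qed.

Lemma pintP x y : (forall n, x n = y n) -> x = y.
Proof. by move=> xy; apply: val_inj; apply/funext. Qed.

Lemma pint_coh x n : x n = (x n.+1 %% p ^ n)%N.
Proof. by case: x => f /= /asboolP. Qed.

Lemma pint_mod x n : (x n %% p ^ n)%N = x n.
Proof. by rewrite (pint_coh x n) modn_mod. Qed.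

Fact coherentP (f : nat -> nat) :
  (forall n, f n.+1 = f n %[mod p ^ n]) -> coherent (fun n => f n %% p ^ n)%N.
Proof.
move=> fP; apply/asboolP => n.
by rewrite modn_dvdm ?dvdn_exp2l// fP.
Qed.

Definition pint_of (f : nat -> nat) (fP : forall n, f n.+1 = f n %[mod p ^ n]) :
  Zp := PadicInt p_pr (coherentP fP).

Let cohm x n : x n.+1 = x n %[mod p ^ n].
Proof. by rewrite -pint_coh pint_mod. Qed.

Fact pint_add_subproof x y n : (x n.+1 + y n.+1 = x n + y n %[mod p ^ n])%N.
Proof. by rewrite -modnDm !cohm modnDm. Qed.
Definition pint_add x y : Zp := pint_of (pint_add_subproof x y).

Fact pint_mul_subproof x y n : (x n.+1 * y n.+1 = x n * y n %[mod p ^ n])%N.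
Proof. by rewrite -modnMm !cohm modnMm. Qed.
Definition pint_mul x y : Zp := pint_of (pint_mul_subproof x y).

Fact pint_opp_subproof x n :
  ((p ^ n.+1).-1 * x n.+1 = (p ^ n).-1 * x n %[mod p ^ n])%N.
Proof.
apply/eqP; rewrite -(eqn_modDr (x n.+1)).
rewrite -[X in (_ + X)%N]mul1n -mulnDl addn1 prednK//.
rewrite -(modnDm _ (x n.+1)) cohm modnDm.
rewrite -[X in (_ == _ * _ + X %[mod _])%N]mul1n -mulnDl addn1 prednK//.
by rewrite expnS -mulnA mulnCA !modnMr.
Qed.
(* - x is represented by (p^n - 1) x_n modulo p^n *)
Definition pint_opp x : Zp := pint_of (pint_opp_subproof x).

Definition pint_nat (k : nat) : Zp := pint_of (fun n : nat => erefl (k %% p ^ n)%N).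

Fact pint_addA : associative pint_add.
Proof. by move=> x y z; apply: pintP => n /=; rewrite modnDmr modnDml addnA. Qed.
Fact pint_addC : commutative pint_add.
Proof. by move=> x y; apply: pintP => n /=; rewrite addnC. Qed.
Fact pint_add0 : left_id (pint_nat 0) pint_add.
Proof. by move=> x; apply: pintP => n /=; rewrite mod0n add0n pint_mod. Qed.
Fact pint_addN : left_inverse (pint_nat 0) pint_opp pint_add.
Proof.
move=> x; apply: pintP => n /=.
by rewrite modnDml -{2}[x n]mul1n -mulnDl addn1 prednK// modnMr mod0n.
Qed.
HB.instance Definition _ :=
  GRing.isZmodule.Build Zp pint_addA pint_addC pint_add0 pint_addN.

Fact pint_mulA : associative pint_mul.
Proof. by move=> x y z; apply: pintP => n /=; rewrite modnMmr modnMml mulnA. Qed.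
Fact pint_mulC : commutative pint_mul.
Proof. by move=> x y; apply: pintP => n /=; rewrite mulnC. Qed.
Fact pint_mul1 : left_id (pint_nat 1) pint_mul.
Proof. by move=> x; apply: pintP => n /=; rewrite modnMml mul1n pint_mod. Qed.
Fact pint_mulDl : left_distributive pint_mul pint_add.
Proof.
by move=> x y z; apply: pintP => n /=; rewrite modnMml modnDm mulnDl.
Qed.
Fact pint_1neq0 : pint_nat 1 != 0.
Proof.
apply/eqP => /(congr1 (fun z : Zp => z 1%N)) /=.
by rewrite expn1 mod0n modn_small.
Qed.
HB.instance Definition _ := GRing.Zmodule_isComNzRing.Build Zp
  pint_mulA pint_mulC pint_mul1 pint_mulDl pint_1neq0.

Definition pint_unit : {pred Zp} := fun x => `[< exists y, y * x = 1 >].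
Definition pint_inv x : Zp := xget x [set y | y * x = 1].

Fact pint_mulVx : {in pint_unit, left_inverse 1 pint_inv *%R}.
Proof.
move=> x; rewrite unfold_in => /asboolP xP; rewrite /pint_inv.
by case: xgetP => // /(_ _) h; case: xP => y /h.
Qed.
Fact pint_unitPl x y : y * x = 1 -> pint_unit x.
Proof. by move=> yx; apply/asboolP; exists y. Qed.
Fact pint_invr_out : {in [predC pint_unit], pint_inv =1 id}.
Proof.
move=> x; rewrite inE unfold_in => /asboolP xP; rewrite /pint_inv.
by case: xgetP => // y _ yx; case: xP; exists y.
Qed.
HB.instance Definition _ := GRing.ComNzRing_hasMulInverse.Build Zp
  pint_mulVx pint_unitPl pint_invr_out.

Fact pint_neq0 x : x != 0 -> exists n, x n.+1 != 0%N.
Proof.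
move=> x0; apply: contrapT => /forallNP h; move/eqP: x0; apply.
by apply: pintP => n; rewrite (pint_coh x); have /negP := h n; rewrite negbK => /eqP ->.
Qed.

(* The p-adic valuation on Z_p: the largest n such that p^n divides x
   (0 by convention when x = 0). *)
Definition pint_valuation x : nat :=
  if pselect (exists n, x n.+1 != 0%N) is left xn then ex_minn xn else 0%N.


Fact pint_valuationP x n : x != 0 -> (n <= pint_valuation x)%N = (x n == 0%N).
Proof.
move=> x0; rewrite /pint_valuation; case: pselect => [e|]; last first.
  by case; exact: pint_neq0.
case: ex_minnP => m xm mmin.
have dwn i k : x (i + k)%N = 0%N -> x i = 0%N.
  elim: k => [|k IHk]; rewrite ?addn0// addnS => h; apply: IHk.
  by rewrite pint_coh h mod0n.
apply/idP/eqP => [nm|xn0].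
  case: n nm => [_|n nm]; first by rewrite pint_coh expn0 modn1.
  by apply/eqP; apply: contraTT nm => /mmin; rewrite -leqNgt.
rewrite leqNgt; apply/negP => mn; move/eqP: xm; apply.
by apply: (dwn _ (n - m.+1)%N); rewrite subnKC.
Qed.

Fact pint_logn x n : x != 0 -> (pint_valuation x < n)%N ->
  (x n != 0%N) && (logn p (x n) == pint_valuation x).
Proof.
move=> x0 vn; have xn0 : x n != 0%N by rewrite -pint_valuationP// -ltnNge.
rewrite xn0 /=; have red k : (k <= n)%N -> x k = (x n %% p ^ k)%N.
  move=> /subnKC <-; elim: (n - k)%N => [|i IHi]; first by rewrite addn0 pint_mod.
  by rewrite addnS IHi pint_coh modn_dvdm// dvdn_exp2l// leq_addr.
rewrite eqn_leq; apply/andP; split; rewrite leqNgt; apply/negP.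
  rewrite -[(_ < _)%N]/(_ <= _)%N -pfactor_dvdn ?lt0n// /dvdn -red//.
  by rewrite -pint_valuationP// ltnn.
move=> lv; have : (pint_valuation x <= logn p (x n))%N.
  by rewrite -pfactor_dvdn ?lt0n// /dvdn -red ?(ltnW vn)// -pint_valuationP.
by rewrite leqNgt lv.
Qed.

Fact pint_mul_valuation x y : x != 0 -> y != 0 ->
  (x * y != 0) /\ pint_valuation (x * y) = (pint_valuation x + pint_valuation y)%N.
Proof.
move=> x0 y0; set a := pint_valuation x; set b := pint_valuation y.
pose n := (a + b).+1.
have /andP[xn /eqP lx] : (x n != 0%N) && (logn p (x n) == a).
  by apply: pint_logn; rewrite // ltnS leq_addr.
have /andP[yn /eqP ly] : (y n != 0%N) && (logn p (y n) == b).
  by apply: pint_logn; rewrite // ltnS leq_addl.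
have xyE k : (x * y) k = (x k * y k %% p ^ k)%N by [].
have xyn : (x * y) n != 0%N.
  rewrite xyE -/(dvdn _ _) pfactor_dvdn// ?muln_gt0 ?lt0n ?xn ?yn//.
  by rewrite lognM ?lt0n// lx ly ltnn.
have xy0 : x * y != 0 by apply: contraNneq xyn => ->; rewrite /= mod0n.
split=> //; apply/eqP; rewrite eqn_leq; apply/andP; split.
  by rewrite leqNgt pint_valuationP.
rewrite pint_valuationP// pint_coh xyE modn_dvdm ?dvdn_exp2l//.
rewrite -/(dvdn _ _) pfactor_dvdn// ?muln_gt0 ?lt0n ?xn ?yn//.
by rewrite lognM ?lt0n// lx ly leqnn.
Qed.

Fact pint_integral : GRing.integral_domain_axiom Zp.
Proof.
move=> x y xy0; have [//|x0] := eqVneq x 0; have [//|y0] := eqVneq y 0.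
by have [] := pint_mul_valuation x0 y0; rewrite xy0 eqxx.
Qed.
HB.instance Definition _ := GRing.ComUnitRing_isIntegral.Build Zp pint_integral.

Fact pint_valuationD x y n : x + y != 0 ->
  (x != 0 -> (n <= pint_valuation x)%N) -> (y != 0 -> (n <= pint_valuation y)%N) ->
  (n <= pint_valuation (x + y)%R)%N.
Proof.
move=> xy0 nx ny; rewrite pint_valuationP//.
have van z : (z != 0 -> (n <= pint_valuation z)%N) -> z n = 0%N.
  have [->|z0 /(_ isT)] := eqVneq z 0; first by rewrite /= mod0n.
  by rewrite pint_valuationP// => /eqP.
by rewrite [X in X == _]/= (van _ nx) (van _ ny) mod0n.
Qed.

Fact pint_valuationN x : x != 0 -> pint_valuation (- x) = pint_valuation x.
Proof.
move=> x0; have n1 : -1 != 0 :> Zp by rewrite oppr_eq0 oner_eq0.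
have v1 : pint_valuation (-1 : Zp) = 0%N.
  have [_] := pint_mul_valuation n1 n1; rewrite mulrNN mulr1 => e1.
  have [_] := pint_mul_valuation (oner_neq0 Zp) (oner_neq0 Zp).
  rewrite mulr1 => /eqP; rewrite -{1}[pint_valuation 1]addn0 eqn_add2l => /eqP e2.
  by move: e1; rewrite -e2 => /esym/eqP; rewrite addn_eq0 => /andP[/eqP].
by rewrite -mulN1r (pint_mul_valuation n1 x0).2 v1.
Qed.

End PadicIntegers.

Section PadicNumbers.
Local Open Scope quotient_scope.
Variables (p : nat) (p_pr : prime p).

Definition padic (p_pr : prime p) := {fraction padic_int p_pr}.
HB.instance Definition _ := GRing.Field.on (padic p_pr).
HB.instance Definition _ := isPointed.Build (padic p_pr) 0.

Local Notation Qp := (padic p_pr).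
Local Notation v := (@pint_valuation p p_pr).
Implicit Types x y : Qp.

Definition padic_valuation x : int :=
  (v (frac (repr x)).1)%:Z - (v (frac (repr x)).2)%:Z.

(* |x|_p, as a rational number *)
Definition padic_abs x : rat :=
  if x == 0 then 0 else p%:R ^ (- padic_valuation x).

Local Notation "a %:F" := (@tofrac _ a).
Let p_gt0 : (0 : rat) < p%:R. Proof. by rewrite ltr0n prime_gt0. Qed.
Let p_neq0 : (p%:R : rat) != 0. Proof. by rewrite gt_eqF. Qed.
Let p_ge1 : (1 : rat) <= p%:R. Proof. by rewrite ler1n prime_gt0. Qed.

Fact padic_repr x : x = (frac (repr x)).1%:F / (frac (repr x)).2%:F.
Proof.
have d0 : ((frac (repr x)).2)%:F != 0 :> Qp by rewrite tofrac_eq0 denom_ratioP.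
apply: (mulIf d0); rewrite divfK// -{1}[x]reprK; set r := repr x; unlock tofrac.
rewrite -[LHS]FracField.pi_mul; apply/eqmodP; rewrite /= FracField.equivfE.
rewrite /FracField.mulf !numden_Ratio ?oner_neq0 ?mulr1 ?denom_ratioP//.
by rewrite mulrC.
Qed.

Fact padic_fracP x : exists a b : padic_int p_pr, b != 0 /\ x = a%:F / b%:F.
Proof.
exists (frac (repr x)).1, (frac (repr x)).2; split; last exact: padic_repr.
exact: denom_ratioP.
Qed.

Fact padic_valuationE (a b : padic_int p_pr) : a != 0 -> b != 0 ->
  padic_valuation (a%:F / b%:F) = (v a)%:Z - (v b)%:Z.
Proof.
move=> a0 b0; rewrite /padic_valuation; set x := a%:F / b%:F.
have x0 : x != 0 by rewrite mulf_eq0 invr_eq0 !tofrac_eq0 negb_or a0.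
have := padic_repr x; set n := (frac _).1; set d := (frac _).2 => xE.
have d0 : d != 0 by exact: denom_ratioP.
have n0 : n != 0 by apply: contra_neq x0 => n0; rewrite xE n0 tofrac0 mul0r.
have : a * d = n * b.
  apply/eqP; rewrite -tofrac_eq !tofracM -eqr_div ?tofrac_eq0//.
  by rewrite -/x {1}xE.
move=> /(congr1 v); rewrite (pint_mul_valuation a0 d0).2 (pint_mul_valuation n0 b0).2.
lia.
Qed.

Fact padic_absE (a b : padic_int p_pr) : a != 0 -> b != 0 ->
  padic_abs (a%:F / b%:F) = p%:R ^ ((v b)%:Z - (v a)%:Z).
Proof.
move=> a0 b0; rewrite /padic_abs mulf_eq0 invr_eq0 !tofrac_eq0 (negPf a0) (negPf b0).
by rewrite padic_valuationE// opprB.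
Qed.

Fact padic_abs_ge0 x : 0 <= padic_abs x.
Proof. by rewrite /padic_abs; case: ifP => // _; rewrite exprz_ge0// ltW. Qed.

Fact padic_absN x : padic_abs (- x) = padic_abs x.
Proof.
have [a [b [b0 ->]]] := padic_fracP x.
have [->|a0] := eqVneq a 0; first by rewrite tofrac0 mul0r oppr0.
by rewrite -mulNr -tofracN !padic_absE ?oppr_eq0// pint_valuationN.
Qed.

Fact padic_absD x y : padic_abs (x + y) <= Num.max (padic_abs x) (padic_abs y).
Proof.
have [a [d [d0 ->]]] := padic_fracP x; have [b [e [e0 ->]]] := padic_fracP y.
have [xy0|] := eqVneq (a%:F / d%:F + b%:F / e%:F) 0.
  by rewrite xy0 {1}/padic_abs eqxx le_max padic_abs_ge0.
have d1 : d%:F != 0 by rewrite tofrac_eq0.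
have e1 : e%:F != 0 by rewrite tofrac_eq0.
rewrite -[a%:F / d%:F]mulr1 -(divff e1) -[b%:F / e%:F]mulr1 -(divff d1).
rewrite !mulf_div [e%:F * d%:F]mulrC -mulrDl -!tofracM -tofracD; set A := a * e; set B := b * d; set D := d * e.
have D0 : D != 0 by rewrite mulf_neq0.
rewrite mulf_eq0 invr_eq0 !tofrac_eq0 (negPf D0) orbF => AB0.
have [A0|A0] := eqVneq A 0; first by rewrite A0 add0r le_max lexx orbT.
have [B0|B0] := eqVneq B 0; first by rewrite B0 addr0 le_max lexx.
rewrite !padic_absE//.
have [vAB|vBA] := leqP (v A) (v B).
  rewrite le_max; apply/orP; left; apply: ler_weXz2l => //.
  by rewrite lerD2l lerN2 lez_nat; apply: pint_valuationD.
rewrite le_max; apply/orP; right; apply: ler_weXz2l => //.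
by rewrite lerD2l lerN2 lez_nat; apply: pint_valuationD => // _; exact: ltnW.
Qed.

(* B_N *)
Definition padic_ball (N : int) : {pred Qp} := fun x => padic_abs x <= p%:R ^ N.

Fact padic_ball_zmod_closed N : zmod_closed (padic_ball N).
Proof.
split=> [|x y]; rewrite !unfold_in.
  by rewrite /padic_abs eqxx exprz_ge0// ltW.
by move=> xN yN; rewrite (le_trans (padic_absD _ _))// padic_absN ge_max xN.
Qed.
HB.instance Definition _ N :=
  GRing.isZmodClosed.Build Qp (padic_ball N) (padic_ball_zmod_closed N).

Definition padic_open (A : set Qp) :=
  forall x, A x -> exists2 r : rat, 0 < r & [set y | padic_abs (y - x) < r] `<=` A.

Fact padic_openT : padic_open setT. Proof. by move=> x _; exists 1. Qed.
Fact padic_openI : setI_closed padic_open.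
Proof.
move=> A B oA oB x [/oA[r r0 rA] /oB[s s0 sB]].
exists (Num.min r s); first by rewrite lt_min r0.
by move=> y /=; rewrite lt_min => /andP[yr ys]; split; [exact: rA|exact: sB].
Qed.
Fact padic_open_bigU (I : Type) (f : I -> set Qp) :
  (forall i, padic_open (f i)) -> padic_open (\bigcup_i f i).
Proof.
move=> fo x [i _ /fo[r r0 rf]]; exists r => // y yr; exists i => //; exact: rf.
Qed.
HB.instance Definition _ :=
  isOpenTopological.Build Qp padic_openT padic_openI padic_open_bigU.

(* The Borel sigma-algebra *)
HB.instance Definition _ := Measurable.copy Qp (g_sigma_algebraType (@open Qp)).

End PadicNumbers.

Arguments padic_ball {p} p_pr N _.

Section HarmonicAnalysis.
Local Open Scope complex_scope.
Local Open Scope quotient_scope.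
Variables (R : realType) (p : nat) (p_pr : prime p).
Local Notation Qp := (padic p_pr).
Local Notation C := R[i].
Implicit Types (N : int) (alpha : R) (x y xi : Qp) (u phi : Qp -> C).

(* |x|_p, as a real number *)
Definition pabs x : R := ratr (padic_abs x).

Definition pball N : set Qp := [set` padic_ball p_pr N].

(* dx; here Z_p = B_0.  Together with translation invariance, the normalization
   makes the measure finite and nonzero on compact open sets. *)
Definition normalized_haar (mu : {measure set Qp -> \bar R}) : Prop :=
  (forall (a : Qp) (A : set Qp), measurable A ->
     mu [set a + x | x in A] = mu A) /\
  mu (pball 0) = 1%E.

(* {x}_p: the unique m / p^k in [0, 1[ such that x - m / p^k is in Z_p *)
Definition frac_part x : rat :=
  xget 0 [set r | exists k m : nat, [/\ (m < p ^ k)%N,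
    r = m%:R / p%:R ^+ k & padic_abs (x - m%:R / p%:R ^+ k) <= 1]].

Definition chi x : C :=
  let t : R := 2 * pi * ratr (frac_part x) in cos t +i* sin t.

Definition locally_constant u : Prop := forall x, \forall y \near x, u y = u x.

(* D(Q_p) *)
Definition test_function u : Prop :=
  locally_constant u /\ compact (closure [set x | u x != 0]).

(* D(B_N), as the functions in D(Q_p) that vanish outside of B_N *)
Definition test_function_on N u : Prop :=
  test_function u /\ [set x | u x != 0] `<=` pball N.

Definition restrict0 N u : Qp -> C := patch (cst 0) (pball N) u.

Definition vlad_const alpha : R :=
  (1 - p%:R `^ alpha) / (1 - p%:R `^ (- alpha - 1)).

Definition lambda N alpha : R :=
  (p%:R - 1) / (p%:R `^ (alpha + 1) - 1) * p%:R `^ (alpha * (1 - N)%:~R).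

(* For f in D'(B_N) and phi in D(B_N); only the values of f on D(B_N) matter,
   since phi (x - .) is in D(B_N) for x in B_N. *)
Definition convolution N (f : (Qp -> C) -> C) phi : Qp -> C :=
  restrict0 N (fun x => f (fun y => phi (x - y))).

(* The dual group Q_p / B_{-N} of B_N *)
Definition dual N := Quotient.quot (padic_ball p_pr (- N)).

Variable mu : {measure set Qp -> \bar R}.

Definition cintegral (D : set Qp) (f : Qp -> C) : C :=
  (\int[mu]_(x in D) complex.Re (f x)) +i* (\int[mu]_(x in D) complex.Im (f x)).

Definition fourier u xi : C := cintegral setT (fun x => chi (x * xi) * u x).

Definition fourier_inv u x : C :=
  cintegral setT (fun xi => chi (- (x * xi)) * u xi).

Definition vladimirov alpha u : Qp -> C :=
  fourier_inv (fun xi => (pabs xi `^ alpha)%:C * fourier u xi).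

Definition vladimirov_on N alpha phi : Qp -> C :=
  restrict0 N (vladimirov alpha phi).

(* f^(N)_{-alpha} *)
Definition f_distr N alpha phi : C :=
  (lambda N alpha)%:C * phi 0 + (vlad_const alpha)%:C *
    cintegral (pball N) (fun x => (phi x - phi 0) * (pabs x `^ (- alpha - 1))%:C).

(* The value does not depend on the representative of c: chi is additive and
   trivial on Z_p, which contains B_N * B_{-N}. *)
Definition fourier_on N phi (c : dual N) : C :=
  (p%:R ^ (- N))%:C * cintegral (pball N) (fun x => chi (x * repr c) * phi x).

(* The inverse of the bijection fourier_on from D(B_N) onto the finitely
   supported functions on the dual group; 0 outside of the image. *)
Definition fourier_on_inv N (g : dual N -> C) : Qp -> C :=
  xget (cst 0) [set phi | test_function_on N phi /\ fourier_on phi = g].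

(* P_{N, alpha} *)
Definition symbol N alpha xi : C :=
  (vlad_const alpha)%:C *
    cintegral (pball N) (fun y => (pabs y `^ (- alpha - 1))%:C * (chi (y * xi) - 1)).

End HarmonicAnalysis.

(* Main.v *)
Require Import Defs.
From mathcomp Require Import all_boot all_order all_algebra.
From mathcomp Require Import fraction generic_quotient ring_quotient.
From mathcomp Require Import all_classical all_reals all_analysis.
From mathcomp Require Import complex.
From mathcomp Require Import zify ring lra.
Set Implicit Arguments.
Unset Strict Implicit.
Unset Printing Implicit Defensive.
Import Order.TTheory GRing.Theory Num.Theory.
Local Open Scope classical_set_scope.
Local Open Scope quotient_scope.
Local Open Scope ring_scope.
Local Open Scope complex_scope.

(** On [B_N] a test function that is invariant under [B_{N-K}] is a finite sum of
    characters [chi (x * xi_k)], [xi_k = k p^(K-N)], [0 <= k < p^K], because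
    [B_N / B_{N-K}] is cyclic of order [p^K].  All the operators of the theorem are
    diagonal on these characters.  If [xi] lies outside [B_{-N}], then [|.|_p] is
    constant on the coset [xi + B_{-N}], so the eigenvalue of [D^alpha_N] is
    [|xi|_p^alpha]; on the trivial coset it is the average of [|.|_p^alpha] over
    [B_{-N}], which is [lambda].  Summing over the spheres in [B_N] gives
    [P_{N,alpha}(xi)] = eigenvalue - [lambda] for every [xi]. *)

(** Two integrals are delicate at 0, in different ways. The weight |y|_p^{-alpha-1} is not
    integrable there, but chi(y xi) - 1 vanishes on a small ball, so the integrand of the symbol is
    a step function and everything is a finite sum. In contrast |xi|_p^alpha is integrable but not
    locally constant at 0, so its integral over a ball is a limit over shrinking radii. The average
    over a coset comes from the normalisations. The Fourier transform of a character of frequency xi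
    cut off to B_N is p^N times the indicator of -xi + B_{-N}. For x in B_N the factor chi(-(x eta))
    of the inverse transform is constant for eta in this coset, whose measure p^{-N} cancels p^N.
    The minus sign is harmless because the eigenvalue is even in xi. *)

Lemma subr_divf (F : fieldType) (a b c : F) : b != 0 -> a / b - c = (a - c * b) / b.
Proof. by move=> b0; rewrite mulrBl mulfK. Qed.

(** * The p-adic absolute value, balls, and representatives of their finite quotients *)

Section PadicBalls.
Variables (p : nat) (p_pr : prime p).
Local Notation Zp := (padic_int p_pr).
Local Notation Qp := (padic p_pr).
Local Notation B := (padic_ball p_pr).
Local Notation "a %:F" := (@FracField.tofrac _ a).
Local Notation P := (p%:R : Qp).
Implicit Types (x y : Qp) (z : Zp) (N M : int) (i j k n K : nat).

Let p_gt0 : (0 : rat) < p%:R. Proof. by rewrite ltr0n prime_gt0. Qed.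
Let p_neq0 : (p%:R : rat) != 0. Proof. by rewrite gt_eqF. Qed.
Let p_gt1 : (1 : rat) < p%:R. Proof. by rewrite ltr1n prime_gt1. Qed.

Lemma padic_abs0 : padic_abs (0 : Qp) = 0.
Proof. by rewrite /padic_abs eqxx. Qed.

Lemma padic_absM x y : padic_abs (x * y) = padic_abs x * padic_abs y.
Proof.
have [a [b [b0 ->]]] := padic_fracP x; have [c [d [d0 ->]]] := padic_fracP y.
have [->|a0] := eqVneq a 0; first by rewrite tofrac0 !mul0r padic_abs0 mul0r.
have [->|c0] := eqVneq c 0.
  by rewrite tofrac0 mul0r mulr0 padic_abs0 mulr0.
rewrite mulf_div -!tofracM !padic_absE ?mulf_neq0// -expfzDr//.
rewrite (pint_mul_valuation b0 d0).2 (pint_mul_valuation a0 c0).2.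
by congr (_ ^ _); lia.
Qed.

Lemma pint_valuation1 : pint_valuation (1 : Zp) = 0%N.
Proof.
have [_] := pint_mul_valuation (oner_neq0 Zp) (oner_neq0 Zp).
by rewrite mulr1 -[LHS]addn0 => /eqP; rewrite eqn_add2l eq_sym => /eqP.
Qed.

Lemma padic_abs_int z : z != 0 ->
  padic_abs (z%:F) = p%:R ^ (- (pint_valuation z)%:Z).
Proof.
move=> z0; rewrite -[z%:F]divr1 -tofrac1 padic_absE ?oner_neq0//.
by rewrite pint_valuation1 sub0r.
Qed.

Lemma padic_ball_int z n : (z%:F \in B (- n%:Z)) = (z n == 0%N).
Proof.
rewrite unfold_in; have [->|z0] := eqVneq z 0.
  by rewrite tofrac0 padic_abs0 exprz_ge0 ?ltW//= mod0n.
by rewrite padic_abs_int// ler_eXz2l// lerN2 lez_nat pint_valuationP.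
Qed.

Lemma tofrac_pint_nat k : (pint_nat p_pr k)%:F = k%:R.
Proof.
elim: k => [|k IHk]; first exact: tofrac0.
rewrite -natr1 -IHk -tofrac1 -tofracD; congr (_%:F); apply: pintP => n /=.
by rewrite modnDm addn1.
Qed.

Lemma padic_ball_nat k n : (k%:R \in B (- n%:Z)) = (p ^ n %| k)%N.
Proof. by rewrite -tofrac_pint_nat padic_ball_int. Qed.

(** The valuation of p is pinned to 1 because p divides p and p^2 does not, both read through
    [padic_ball_nat]; the same obstruction shows that p is nonzero in Q_p. *)
Lemma padic_abs_p : padic_abs P = p%:R ^ (-1).
Proof.
have p0 : pint_nat p_pr p != 0.
  rewrite -tofrac_eq0 tofrac_pint_nat; apply/eqP => p0.
  have := padic_ball_nat p 2; rewrite p0 rpred0 => /esym/dvdn_leq.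
  rewrite prime_gt0// => /(_ isT); rewrite expnS expn1.
  by have := prime_gt1 p_pr; nia.
have := padic_ball_nat p 1; rewrite expn1 dvdnn -tofrac_pint_nat => h1.
have := padic_ball_nat p 2; rewrite gtnNdvd ?prime_gt0//; last first.
  by rewrite -[ltnLHS]expn1 ltn_exp2l// prime_gt1.
rewrite -tofrac_pint_nat => h2; move: h1 h2; rewrite !unfold_in padic_abs_int//.
rewrite !ler_eXz2l// => h1 /negbT; rewrite -ltNge => h2.
by congr (_ ^ _); lia.
Qed.

Lemma padic_p_neq0 : P != 0.
Proof.
apply/eqP => P0; have := padic_abs_p; rewrite P0 padic_abs0.
by move=> /eqP; rewrite eq_sym expfz_eq0 (negPf p_neq0) andbF.
Qed.
Local Hint Resolve padic_p_neq0 : core.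

Lemma padic_abs1 : padic_abs (1 : Qp) = 1.
Proof.
by rewrite -tofrac1 padic_abs_int ?oner_neq0// pint_valuation1 oppr0 expr0z.
Qed.

Lemma padic_absV x : padic_abs x^-1 = (padic_abs x)^-1.
Proof.
have [->|x0] := eqVneq x 0; first by rewrite invr0 padic_abs0 invr0.
have := padic_absM x x^-1; rewrite divff// padic_abs1 => e.
have ax0 : padic_abs x != 0.
  by apply/eqP => ax0; move/eqP: e; rewrite ax0 mul0r oner_eq0.
by apply: (mulfI ax0); rewrite -e divff.
Qed.

Lemma padic_abs_ppow M : padic_abs (P ^ M) = p%:R ^ (- M).
Proof.
have pn n : padic_abs (P ^+ n) = p%:R ^ (- n%:Z).
  elim: n => [|n IHn]; first by rewrite expr0 padic_abs1 oppr0 expr0z.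
  by rewrite exprS padic_absM IHn padic_abs_p -expfzDr//; congr (_ ^ _); lia.
case: M => n; first exact: pn.
by rewrite NegzE -invr_expz padic_absV (pn n.+1) invr_expz.
Qed.

Lemma padic_ballM x y M N : x \in B M -> y \in B N -> x * y \in B (M + N).
Proof.
by rewrite !unfold_in padic_absM expfzDr// => xM yN; rewrite ler_pM// padic_abs_ge0.
Qed.

Lemma padic_ball_le x M N : M <= N -> x \in B M -> x \in B N.
Proof. by rewrite !unfold_in => MN /le_trans; apply; rewrite ler_eXz2l. Qed.

Lemma padic_ball_ppow M N : (P ^ M \in B N) = (- M <= N).
Proof. by rewrite unfold_in padic_abs_ppow ler_eXz2l. Qed.

Lemma padic_ballZ x M N : (x * P ^ M \in B N) = (x \in B (N + M)).
Proof.
apply/idP/idP => [xN|xM].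
  have := padic_ballM xN (_ : P ^ (- M) \in B M).
  by rewrite -mulrA -expfzDr// subrr expr0z mulr1; apply; rewrite padic_ball_ppow opprK.
have := padic_ballM xM (_ : P ^ M \in B (- M)).
by rewrite addrK; apply; rewrite padic_ball_ppow.
Qed.

Lemma padic_abs_cases x : x = 0 \/ exists M, padic_abs x = p%:R ^ M.
Proof.
rewrite /padic_abs; have [|_] := eqVneq x 0; [by left|right].
by exists (- padic_valuation x).
Qed.

Lemma padic_notin_ball x N : x \notin B N ->
  exists2 M, N < M & padic_abs x = p%:R ^ M.
Proof.
have [->|[M xM]] := padic_abs_cases x; first by rewrite rpred0.
by rewrite unfold_in xM ler_eXz2l// -ltNge => NM; exists M.
Qed.

Lemma padic_ball_ex x : exists n : nat, x \in B n%:Z.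
Proof.
have [->|[M xM]] := padic_abs_cases x; first by exists 0%N; rewrite rpred0.
by exists `|M|%N; rewrite unfold_in xM ler_eXz2l//; lia.
Qed.

(** By the ultrametric inequality a perturbation of size at most p^N cannot alter an absolute value
    larger than p^N. This is what makes |.|_p constant on nontrivial cosets. *)
Lemma padic_absB_eq x y N : x - y \in B N -> x \notin B N ->
  padic_abs x = padic_abs y.
Proof.
move=> xyN xN; have h := xN; have yN : y \notin B N.
  by apply: contra xN => yN; rewrite -(subrK y x) rpredD.
move: xyN xN yN; rewrite !unfold_in -!ltNge => xyN xN yN.
have xx : x = (x - y) + y by rewrite subrK.
have yy : y = x + (- (x - y)) by rewrite opprB addrC subrK.
apply/eqP; rewrite eq_le; apply/andP; split.
  have := padic_absD (x - y) y; rewrite -xx le_max => /orP[] // h1.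
  by have := lt_le_trans xN h1; rewrite ltNge xyN.
have := padic_absD x (- (x - y)); rewrite -yy padic_absN le_max => /orP[] // h1.
by have := lt_le_trans yN h1; rewrite ltNge xyN.
Qed.

Lemma pint_sub_eq0 (a c : Zp) n : c n = a n -> (a - c)%R n = 0%N.
Proof.
move=> cn; pose d : Zp := a - c.
have e : a n = ((d n + c n) %% p ^ n)%N by rewrite -{1}[a](subrK c).
rewrite cn in e; rewrite -/d.
have lt : (d n < p ^ n)%N by rewrite -pint_mod ltn_mod expn_gt0 prime_gt0.
apply/eqP; have /eqP : (0 + a n = d n + a n %[mod p ^ n])%N.
  by rewrite -e add0n pint_mod.
by rewrite eqn_modDr mod0n modn_small// eq_sym.
Qed.

(** Writing x = a / b with v(b) <= v(a), the integer i must solve a = i b to sufficient precision.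
    Once p^v(b) is removed from both residues, the residue of b is prime to p and can be
    inverted. *)
Lemma padic_abs_le1_approx x K : x \in B 0 ->
  exists2 i, (i < p ^ K)%N & x - i%:R \in B (- K%:Z).
Proof.
case: K => [x0|K]; first by exists 0%N; rewrite ?expn0// subr0.
have pX n : (0 < p ^ n)%N by rewrite expn_gt0 prime_gt0.
have [a [b [b0 ->]]] := padic_fracP x.
have [->|a0] := eqVneq a 0.
  by exists 0%N => //; rewrite tofrac0 mul0r subr0 rpred0.
rewrite unfold_in padic_absE// ler_eXz2l// subr_le0 lez_nat => ba.
(* Division by b costs m digits, so the numerators are compared modulo p^n. The successor in n makes
   it exceed m, which keeps the residue [b n] nonzero. *)
set m := pint_valuation b in ba; set n := (K.+1 + m)%N.
have /andP[bn /eqP lbn] : (b n != 0%N) && (logn p (b n) == m).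
  by apply: pint_logn => //; rewrite /n; lia.
have red (c : Zp) k l : (k <= l)%N -> c k = (c l %% p ^ k)%N.
  move=> /subnKC <-; elim: (l - k)%N => [|i IHi]; first by rewrite addn0 pint_mod.
  by rewrite addnS IHi pint_coh modn_dvdm// dvdn_exp2l// leq_addr.
have /dvdnP[a' a'E] : (p ^ m %| a n)%N.
  rewrite /dvdn -red ?leq_addl//.
  by rewrite -pint_valuationP.
have bn_gt0 : (0 < b n)%N by rewrite lt0n.
have [b' pb' b'E] := pfactor_coprime p_pr bn_gt0.
rewrite lbn in b'E.
have : coprime b' (p ^ K.+1) by rewrite coprime_sym coprimeXl.
have b'0 : (0 < b')%N.
  by rewrite lt0n; apply: contraNneq bn => b'0; rewrite b'E b'0.
(* Bezout gives u b' = w p^(K+1) + 1, so u inverts b' modulo p^(K+1) and u a' is the sought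
   quotient. *)
have [u w uw _ /eqP g1] := egcdnP (p ^ K.+1) b'0; rewrite g1 in uw.
exists ((u * a') %% p ^ K.+1)%N; first by rewrite ltn_mod.
set i := (_ %% _)%N.
have -> : a%:F / b%:F - i%:R = (a - pint_nat p_pr i * b)%:F / b%:F.
  rewrite tofracB tofracM tofrac_pint_nat.
  by apply: subr_divf; rewrite tofrac_eq0.
have -> : - K.+1%:Z = - n%:Z + m%:Z by rewrite /n; lia.
apply: padic_ballM; last first.
  by rewrite unfold_in padic_absV padic_abs_int// -/m invr_expz opprK.
rewrite padic_ball_int; apply/eqP.
have : (pint_nat p_pr i * b) n = a n.
  rewrite [LHS]/= -[RHS]pint_mod.
  rewrite modnMml /i a'E b'E expnD.
  rewrite mulnA ![(_ * p ^ m)%N]mulnC -!muln_modr; congr (_ * _)%N.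
  by rewrite modnMml -mulnA [(a' * _)%N]mulnC mulnA uw mulnDl mul1n mulnAC modnMDl.
by move=> cn; apply: pint_sub_eq0.
Qed.

Lemma padic_ball_approx x N K : x \in B N ->
  exists2 i, (i < p ^ K)%N & x - i%:R * P ^ (- N) \in B (N - K%:Z).
Proof.
move=> xN; have /(padic_abs_le1_approx K)[i iK xi] : x * P ^ N \in B 0.
  by rewrite padic_ballZ add0r.
exists i => //; rewrite -[x](mulfK (expfz_neq0 N padic_p_neq0)) invr_expz -mulrBl.
by rewrite padic_ballZ; move: xi; congr (_ \in B _); lia.
Qed.

Lemma padic_natB_ball i j n : i%:R - j%:R \in B (- n%:Z) -> (i = j %[mod p ^ n])%N.
Proof.
wlog ij : i j / (j <= i)%N => [wl|].
  have /orP[ij h|ij h] := leq_total j i; first exact: wl.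
  by apply/esym/wl => //; rewrite -rpredN opprB.
by rewrite -natrB// padic_ball_nat => h; apply/eqP; rewrite eqn_mod_dvd.
Qed.

Lemma padic_ball_rep_inj i j N K : (i < p ^ K)%N -> (j < p ^ K)%N ->
  i%:R * P ^ (- N) - j%:R * P ^ (- N) \in B (N - K%:Z) -> i = j.
Proof.
move=> iK jK; rewrite -mulrBl padic_ballZ addrAC subrr add0r => /padic_natB_ball.
by rewrite !modn_small.
Qed.

Lemma padic_ball_rep i N : i%:R * P ^ (- N) \in B N.
Proof. by rewrite padic_ballZ subrr -[0]oppr0 padic_ball_nat expn0 dvd1n. Qed.

End PadicBalls.

(** * The exponential exp(2 pi i t) and sums over roots of unity *)

Section CircleExponential.
Variable R : realType.
Implicit Types s t : R.

Definition expi2pi t : R[i] := cos (2 * pi * t) +i* sin (2 * pi * t).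

Lemma expi2piD s t : expi2pi (s + t) = expi2pi s * expi2pi t.
Proof.
by apply/eqP; rewrite /expi2pi mulrDr cosD sinD eq_complex /= eqxx /= addrC.
Qed.

Lemma expi2pi0 : expi2pi 0 = 1.
Proof. by rewrite /expi2pi mulr0 cos0 sin0. Qed.

Lemma expi2piMn n t : expi2pi (n%:R * t) = expi2pi t ^+ n.
Proof.
elim: n => [|n IHn]; first by rewrite mul0r expi2pi0 expr0.
by rewrite -natr1 mulrDl mul1r expi2piD IHn exprSr.
Qed.

Lemma expi2pi_nat n : expi2pi n%:R = 1.
Proof.
rewrite -[n%:R]mulr1 expi2piMn [expi2pi 1]/expi2pi mulr1 mulr_natl.
by rewrite cos2pi sin2pi expr1n.
Qed.

(** The real part suffices: cos(2 pi t) = 1 - 2 sin(pi t)^2, and sin(pi t) > 0 for 0 < t < 1. *)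
Lemma expi2pi_eq1 t : 0 <= t < 1 -> expi2pi t = 1 -> t = 0.
Proof.
move=> /andP[t0 t1] [+ _]; apply: contra_eq => tn0.
have {}t0 : 0 < t by rewrite lt0r tn0.
have -> : 2 * pi * t = (pi * t) *+ 2 by rewrite -mulrA mulr_natl.
have sp : 0 < sin (pi * t).
  by rewrite sin_gt0_pi// mulr_gt0 ?pi_gt0//= gtr_pMr ?pi_gt0.
rewrite cos_mulr2n cos2sin2 lt_eqF//.
have : 0 < sin (pi * t) ^+ 2 by rewrite exprn_gt0.
lra.
Qed.

Lemma expi2pi_mod d m n : (0 < d)%N -> (m = n %[mod d])%N ->
  expi2pi (m%:R / d%:R) = expi2pi (n%:R / d%:R).
Proof.
move=> d0 mn; have d0' : d%:R != 0 :> R by rewrite pnatr_eq0 -lt0n.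
have red k : expi2pi (k%:R / d%:R) = expi2pi ((k %% d)%:R / d%:R).
  rewrite {1}(divn_eq k d) natrD natrM mulrDl mulfK// expi2piD.
  by rewrite expi2pi_nat mul1r.
by rewrite red mn -red.
Qed.

Lemma sum_expr_unity n (w : R[i]) : w ^+ n = 1 ->
  \sum_(k < n) w ^+ k = if w == 1 then n%:R else 0.
Proof.
move=> wn; case: eqP => [->|/eqP w1].
  under eq_bigr do rewrite expr1n.
  by rewrite sumr_const card_ord.
have := subrX1 w n; rewrite wn subrr => /esym/eqP.
by rewrite mulf_eq0 subr_eq0 (negPf w1) => /eqP.
Qed.

End CircleExponential.

(** * The additive character of Q_p: additivity, kernel, orthogonality *)

Section AdditiveCharacter.
Variables (R : realType) (p : nat) (p_pr : prime p).
Local Notation Qp := (padic p_pr).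
Local Notation B := (padic_ball p_pr).
Local Notation P := (p%:R : Qp).
Local Notation chi := (@chi R p p_pr).
Implicit Types (x y : Qp) (k m n K : nat) (M N : int).

Let p_neq0 (F : numFieldType) : p%:R != 0 :> F.
Proof. by rewrite pnatr_eq0 -lt0n prime_gt0. Qed.

Let P_neq0 : P != 0 := padic_p_neq0 p_pr.

(** Over the common denominator p^(k+k') an integral p-adic difference is a congruence of
    numerators, which shifts the real exponent by an integer. The auxiliary identity [e] is stated
    for any field so that it serves both in R and in Q_p. *)
Lemma expi2pi_padic k m k' m' : (m%:R / P ^+ k - m'%:R / P ^+ k' \in B 0) ->
  expi2pi (m%:R / p%:R ^+ k) = expi2pi (m'%:R / p%:R ^+ k') :> R[i].
Proof.
have e (F : fieldType) (a : nat) l l' : (p%:R : F) != 0 ->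
    a%:R / p%:R ^+ l = (a * p ^ l')%:R / (p ^ (l + l'))%:R :> F.
  move=> pF; rewrite expnD !natrM !natrX.
  by rewrite -mulf_div divff ?mulr1// expf_neq0.
have pR := p_neq0 R.
move=> h; rewrite (e R m k k' pR) (e R m' k' k pR).
rewrite [(k' + k)%N]addnC; apply: expi2pi_mod.
  by rewrite expn_gt0 prime_gt0.
apply: (@padic_natB_ball _ p_pr).
move: h; rewrite (e Qp m k k' P_neq0) (e Qp m' k' k P_neq0) [(k' + k)%N]addnC -mulrBl.
by rewrite natrX exprnN padic_ballZ add0r.
Qed.

(** The approximation of x in B_k modulo B_0 shows that the set defining [frac_part] is inhabited,
    so the fallback of [xget] is never taken. *)
Lemma frac_partP x : exists k m, [/\ (m < p ^ k)%N,
  frac_part x = m%:R / p%:R ^+ k & x - m%:R / P ^+ k \in B 0].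
Proof.
rewrite /frac_part; case: xgetP => [r -> [k [m [mk -> h]]]|none].
  by exists k, m; split=> //; rewrite unfold_in expr0z.
have [k xk] := padic_ball_ex x.
have [i ik] := padic_ball_approx k xk; rewrite subrr -exprnN => h.
case: (none (i%:R / p%:R ^+ k)); by exists k, i.
Qed.

(** Frees [chi] from the normalisation m < p^k: a sum of two fractional parts may leave [0, 1[, and
    additivity needs to evaluate [chi] there. *)
Lemma chiE x k m : x - m%:R / P ^+ k \in B 0 ->
  chi x = expi2pi (m%:R / p%:R ^+ k).
Proof.
move=> xm; have [k' [m' [_ fE xm']]] := frac_partP x.
have -> : chi x = expi2pi (ratr (frac_part x)) by [].
rewrite fE fmorph_div rmorphXn /= !ratr_nat; apply: expi2pi_padic.
by rewrite -rpredN opprB -[_ - _](subrKA x) rpredD// -rpredN opprB.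
Qed.

Lemma chiD x y : chi (x + y) = chi x * chi y.
Proof.
have [k [m [_ _ xm]]] := frac_partP x; have [l [n [_ _ yn]]] := frac_partP y.
rewrite (chiE xm) (chiE yn) -expi2piD.
have e (F : fieldType) : (p%:R : F) != 0 -> m%:R / p%:R ^+ k + n%:R / p%:R ^+ l =
    (m * p ^ l + n * p ^ k)%:R / p%:R ^+ (k + l) :> F.
  move=> pF; rewrite natrD !natrM !natrX exprD mulrDl -mulf_div.
  by rewrite divff ?expf_neq0// mulr1 [p%:R ^+ k * _]mulrC -mulf_div divff ?expf_neq0// mulr1.
rewrite (e R (p_neq0 R)); apply: chiE; rewrite -(e Qp P_neq0).
by rewrite opprD addrACA rpredD.
Qed.

Lemma chi_ball0 x : x \in B 0 -> chi x = 1.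
Proof.
move=> x0; rewrite (@chiE x 0 0); last by rewrite mulr0n mul0r subr0.
by rewrite mulr0n mul0r expi2pi0.
Qed.

Lemma chi0 : chi 0 = 1. Proof. by rewrite chi_ball0 ?rpred0. Qed.

(** Here the representative in [0, 1[ matters: the exponential takes the value 1 there only at 0.
    Knowing the exact kernel is what separates distinct frequencies. *)
Lemma chi_eq1 x : (chi x == 1) = (x \in B 0).
Proof.
apply/eqP/idP => [|/chi_ball0//].
have [k [m [mk _ xm]]] := frac_partP x; rewrite (chiE xm) => /expi2pi_eq1 h.
have pk : 0 < p%:R ^+ k :> R by rewrite exprn_gt0// ltr0n prime_gt0.
have /eqP : m%:R / p%:R ^+ k = 0 :> R.
  apply: h; rewrite divr_ge0// ?ltW//= ltr_pdivrMr// mul1r.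
  by rewrite -natrX ltr_nat.
rewrite mulf_eq0 invr_eq0 (gt_eqF pk) orbF pnatr_eq0 => /eqP m0.
by move: xm; rewrite m0 mulr0n mul0r subr0.
Qed.

Lemma chi_eq x y : x - y \in B 0 -> chi x = chi y.
Proof. by move=> xy; rewrite -(subrK y x) chiD chi_ball0// mul1r. Qed.

Lemma chiMn k x : chi (k%:R * x) = chi x ^+ k.
Proof.
elim: k => [|k IHk]; first by rewrite mul0r chi0 expr0.
by rewrite -natr1 mulrDl mul1r chiD IHk exprSr.
Qed.

(** Since p^K x is integral, chi(x) is a p^K-th root of unity and the sum is geometric. All the
    orthogonality relations below come from this one. *)
Lemma sum_chi x K : x \in B K ->
  \sum_(k < p ^ K) chi (k%:R * x) = if x \in B 0 then (p ^ K)%:R else 0.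
Proof.
move=> xK; under eq_bigr do rewrite chiMn.
rewrite sum_expr_unity ?chi_eq1// -chiMn chi_ball0//.
by rewrite natrX mulrC -[_ ^+ _]/(P ^ K%:Z) padic_ballZ add0r.
Qed.

End AdditiveCharacter.

(** * Topology of Q_p and compactness of balls *)

(** The pigeonhole principle of ultrafilters, by peeling off the last piece: either it belongs to F,
    or its complement does and the other pieces cover what is left of A. *)
Lemma ultra_cover (T : Type) (F : set_system T) (n : nat) (A : set T)
    (C : nat -> set T) : UltraFilter F -> F A ->
  (forall x, A x -> exists2 i, (i < n)%N & C i x) ->
  exists2 i, (i < n)%N & F (C i).
Proof.
move=> FU; elim: n A => [|n IHn] A FA AC.
  have [x Ax] := filter_ex FA.
  by have [k] := AC x Ax; rewrite ltn0.
have [FC|FC] := in_ultra_setVsetC (C n) FU; first by exists n.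
have [| |i iN FCi] := IHn (A `&` ~` C n); first exact: filterI.
  move=> x [/AC[ i ]]; rewrite ltnS leq_eqVlt => /orP[/eqP-> //|iN Ci _].
  by exists i.
by exists i => //; exact: ltnW.
Qed.

Section PadicTopology.
Variables (p : nat) (p_pr : prime p).
Local Notation Zp := (padic_int p_pr).
Local Notation Qp := (padic p_pr).
Local Notation B := (padic_ball p_pr).
Local Notation P := (p%:R : Qp).
Implicit Types (x y a : Qp) (i k n K : nat) (m M N : int).

Let p_gt0 : (0 : rat) < p%:R. Proof. by rewrite ltr0n prime_gt0. Qed.
Let p_gt1 : (1 : rat) < p%:R. Proof. by rewrite ltr1n prime_gt1. Qed.

Definition padic_coset a m : set Qp := [set y | y - a \in B m].

Lemma padic_coset0 m : padic_coset 0 m = pball m.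
Proof. by apply/seteqP; split=> y; rewrite /padic_coset /pball/= subr0. Qed.

Lemma padic_openP (A : set Qp) m :
  (forall x h, A x -> h \in B m -> A (x + h)) -> open A.
Proof.
move=> AB; change (@padic_open p p_pr A) => x Ax.
exists (p%:R ^ m); first by rewrite exprz_gt0.
move=> y /= yx; rewrite -(subrK x y) addrC; apply: AB => //.
by rewrite unfold_in ltW.
Qed.

Lemma open_padic_coset a m : open (padic_coset a m).
Proof.
apply: (@padic_openP _ m) => x h; rewrite /padic_coset/= => xm hm.
by rewrite addrAC rpredD.
Qed.

Lemma closed_pball m : closed (pball m : set Qp).
Proof.
rewrite -[pball m]setCK; apply: open_closedC; apply: (@padic_openP _ m) => x h /=.
by move=> xm hm; apply: contra_not xm => xhm; rewrite /pball/= -(addrK h x) rpredB.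
Qed.

Lemma exprz_lt_ex (r : rat) : 0 < r -> exists k : nat, p%:R ^ (- k%:Z) < r.
Proof.
move=> r0; exists (Num.bound r^-1).
rewrite -invr_expz -[ltRHS]invrK ltf_pV2 ?posrE ?invr_gt0 ?exprz_gt0//.
apply: lt_le_trans (archi_boundP _) _; first by rewrite invr_ge0 ltW.
by rewrite -[leRHS]natrX ler_nat ltnW// ltn_expl// prime_gt1.
Qed.

Lemma padic_nbhsP x (A : set Qp) :
  nbhs x A <-> exists k, padic_coset x (- k%:Z) `<=` A.
Proof.
split; last first.
  move=> [k kA]; rewrite nbhsE; exists (padic_coset x (- k%:Z)) => //.
  split; first exact: open_padic_coset.
  by rewrite /padic_coset/= subrr rpred0.
rewrite nbhsE => -[U [oU Ux] UA]; have [r r0 rU] := (oU : padic_open U) x Ux.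
have [k kr] := exprz_lt_ex r0; exists k; apply: subset_trans UA.
apply: subset_trans rU => y; rewrite /padic_coset/= unfold_in => yk.
exact: le_lt_trans kr.
Qed.

(** At each level K an ultrafilter on B_N selects one coset of B_{N-K}, with index f K. Cosets
    selected at consecutive levels meet, so the indices are coherent and form a p-adic integer z;
    the limit is z p^{-N}. *)
Lemma compact_pball N : compact (pball N : set Qp).
Proof.
rewrite compact_ultra => F FU FB.
have cov K : exists i, (i < p ^ K)%N /\
    F (padic_coset (i%:R * P ^ (- N)) (N - K%:Z)).
  have [x /(padic_ball_approx K)//|i iK Fi] :=
    @ultra_cover _ F (p ^ K)%N (pball N)
      (fun i => padic_coset (i%:R * P ^ (- N)) (N - K%:Z)) FU FB.
  by exists i.
have [f fP] := choice cov.
have fc : coherent p f.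
  apply/asboolP => K; have [fK FK] := fP K; have [fS FS] := fP K.+1.
  have [y [yK yS]] := filter_ex (filterI FK FS).
  rewrite -[LHS](modn_small fK); apply: (@padic_natB_ball _ p_pr).
  have {}yS : y - (f K.+1)%:R * P ^ (- N) \in B (N - K%:Z).
    by apply: padic_ball_le yS; lia.
  have := rpredB yS yK; rewrite opprB addrC addrA subrK -mulrBl padic_ballZ.
  by rewrite addrAC subrr add0r.
pose z : Zp := PadicInt p_pr fc.
pose a : Qp := FracField.tofrac z * P ^ (- N).
have az K : a - (f K)%:R * P ^ (- N) \in B (N - K%:Z).
  rewrite /a -mulrBl padic_ballZ addrAC subrr add0r -tofrac_pint_nat -tofracB.
  rewrite padic_ball_int; apply/eqP/pint_sub_eq0 => /=.
  by rewrite modn_small//; case: (fP K).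
exists a; split.
  rewrite /pball/= -(subrK ((f 0%N)%:R * P ^ (- N)) a) rpredD ?padic_ball_rep//.
  by have := az 0%N; rewrite subr0.
move=> A /padic_nbhsP[k kA]; pose K := (`|N|%N + k)%N.
have [_] := fP K; apply: filterS => y /= yK; apply: kA.
rewrite /padic_coset/= -(subrK ((f K)%:R * P ^ (- N)) y) -addrA rpredD//.
  by apply: padic_ball_le yK; rewrite /K; lia.
by rewrite -opprB rpredN; apply: padic_ball_le (az K); rewrite /K; lia.
Qed.

End PadicTopology.

(** * Test functions on B_N as functions invariant under a smaller ball *)

Section TestFunctions.
Variables (R : realType) (p : nat) (p_pr : prime p).
Local Notation Qp := (padic p_pr).
Local Notation C := R[i].
Local Notation B := (padic_ball p_pr).
Implicit Types (u : Qp -> C) (N : int) (K : nat).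

Lemma test_function_on_out N u x :
  test_function_on N u -> x \notin B N -> u x = 0.
Proof.
move=> [_ uN] xN; apply/eqP; apply: contraNT xN => ux; exact: uN.
Qed.

(** Compactness, in its near-covering form with the filter of large K, upgrades local constancy to
    invariance under a single ball B_{N-K}. Analysis on D(B_N) thereby becomes algebra on a finite
    quotient. *)
Lemma test_function_onP N u : test_function_on N u <->
  (forall x, x \notin B N -> u x = 0) /\
  exists K, forall x h, h \in B (N - K%:Z) -> u (x + h) = u x.
Proof.
split=> [uN|[u0 [K uK]]].
  split=> [x|]; first exact: test_function_on_out.
  have [[u_lc _] _] := uN; have u0 := test_function_on_out uN.
  have := (compact_near_coveringP _).1 (@compact_pball p p_pr N) nat \oo
    (fun k x => forall h, h \in B (N - k%:Z) -> u (x + h) = u x) _.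
  move=> []; last first.
    move=> K _ /(_ K (leqnn K)) uK; exists K => x h hK.
    have [xN|xN] := boolP (x \in B N); first exact: uK.
    have hN : h \in B N by apply: padic_ball_le hK; lia.
    rewrite !u0//; apply: contra xN => xhN; by rewrite -(addrK h x) rpredB.
  move=> x _; have /padic_nbhsP[k ku] := u_lc x.
  exists (padic_coset x (- k%:Z), [set j | (`|N| + k <= j)%N]) => /=.
    split; first by apply/padic_nbhsP; exists k.
    by exists (`|N| + k)%N.
  move=> [x' j] [/= x'k jk] h hj.
  have hk : h \in B (- k%:Z) by apply: padic_ball_le hj; lia.
  by rewrite (ku x')// (ku (x' + h))// /padic_coset/= addrAC rpredD.
split; last by move=> x /= ux; apply: contraNT ux => /u0 ->.
split.
  move=> x; apply/padic_nbhsP; exists (`|N|%N + K)%N => y yx.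
  have := uK x (y - x); rewrite [x + _]addrC subrK; apply; apply: padic_ball_le yx; lia.
apply: (subclosed_compact _ (@compact_pball p p_pr N)).
  exact: closed_closure.
rewrite [X in _ `<=` X](closure_id (pball N)).1; last exact: closed_pball.
apply: closure_subset => x /= ux; apply: contraNT ux => /u0 ->//.
Qed.

End TestFunctions.

(** * Haar measure of balls and complex integrals of step functions *)

Section HaarIntegral.
Variables (R : realType) (p : nat) (p_pr : prime p).
Local Notation Qp := (padic p_pr).
Local Notation C := R[i].
Local Notation B := (padic_ball p_pr).
Local Notation P := (p%:R : Qp).
Local Notation chi := (@chi R p p_pr).
Variable mu : {measure set Qp -> \bar R}.
Implicit Types (D A : set Qp) (f g : Qp -> C) (m M N : int) (k n K : nat).

Let p_gt0 : (0 : R) < p%:R. Proof. by rewrite ltr0n prime_gt0. Qed.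
Let p_neq0 : (p%:R : R) != 0. Proof. by rewrite gt_eqF. Qed.

Lemma padic_open_measurable A : open A -> measurable A.
Proof. by move=> oA; apply: sub_sigma_algebra. Qed.

Lemma measurable_padic_coset a m : measurable (padic_coset a m : set Qp).
Proof. by apply: padic_open_measurable; exact: open_padic_coset. Qed.

Lemma measurable_pball N : measurable (pball N : set Qp).
Proof. by rewrite -padic_coset0; exact: measurable_padic_coset. Qed.
Local Hint Resolve measurable_padic_coset measurable_pball : core.

Lemma pball_cosets N K : (pball N : set Qp) =
  \big[setU/set0]_(j < p ^ K) padic_coset (j%:R * P ^ (- N)) (N - K%:Z).
Proof.
rewrite -(bigcup_mkord _ (fun j : nat => padic_coset (j%:R * P ^ (- N)) (N - K%:Z))).
apply/seteqP; split=> [x /(padic_ball_approx K)[j jK xj]|x [j jK xj]].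
  by exists j.
rewrite /pball/= -(subrK (j%:R * P ^ (- N)) x) rpredD ?padic_ball_rep//.
by apply: padic_ball_le xj; lia.
Qed.

Lemma trivIset_cosets N K (D : set 'I_(p ^ K)) :
  trivIset D (fun j => padic_coset (j%:R * P ^ (- N)) (N - K%:Z) : set Qp).
Proof.
move=> i j _ _ [x [xi xj]]; apply: val_inj.
apply: (@padic_ball_rep_inj _ p_pr _ _ N K _ _ _); [exact: ltn_ord..|].
by have := rpredB xj xi; rewrite opprB addrC addrA subrK.
Qed.

(** [cintegral] has a value for every function but is linear only on integrable ones, so the lemmas
    below usually deliver integrability together with the value. *)
Definition cintegrable D f :=
  mu.-integrable D (EFin \o (fun x => complex.Re (f x))) /\
  mu.-integrable D (EFin \o (fun x => complex.Im (f x))).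

Lemma eq_cintegral D f g : (forall x, D x -> f x = g x) ->
  cintegral mu D f = cintegral mu D g.
Proof.
by move=> fg; rewrite /cintegral; congr (_ +i* _); apply: eq_Rintegral => x;
  rewrite inE => /fg ->.
Qed.

Lemma eq_cintegrable D f g : measurable D -> (forall x, D x -> f x = g x) ->
  cintegrable D f -> cintegrable D g.
Proof.
by move=> mD fg [fR fI]; split; [apply: eq_integrable fR|apply: eq_integrable fI] => // x;
  rewrite inE /= => /fg ->.
Qed.

Lemma cintegral_supp D f : (forall x, ~ D x -> f x = 0) ->
  cintegral mu setT f = cintegral mu D f.
Proof.
move=> f0; rewrite /cintegral !(Rintegral_mkcond _ D); congr (_ +i* _);
  apply: eq_Rintegral => x _; rewrite patchE; case: ifPn => //;
  by rewrite notin_setE => /f0 ->.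
Qed.

Lemma cintegrable_supp D f : measurable D -> (forall x, ~ D x -> f x = 0) ->
  cintegrable D f -> cintegrable setT f.
Proof.
move=> mD f0 [/(integrable_mkcond _ mD) fR /(integrable_mkcond _ mD) fI].
by split; [apply: eq_integrable fR|apply: eq_integrable fI] => // x _;
  rewrite patchE/=; case: ifPn => //; rewrite notin_setE => /f0 ->.
Qed.

(** Three terms, because multiplication by a complex scalar mixes the parts: Re(c f + g) combines Re
    f, Im f and Re g. *)
Let Rintegral_lin3 D (f g h : Qp -> R) a b : measurable D ->
  mu.-integrable D (EFin \o f) -> mu.-integrable D (EFin \o g) ->
  mu.-integrable D (EFin \o h) ->
  mu.-integrable D (EFin \o (fun x => a * f x + b * g x + h x)) /\
  \int[mu]_(x in D) (a * f x + b * g x + h x) =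
    a * \int[mu]_(x in D) f x + b * \int[mu]_(x in D) g x + \int[mu]_(x in D) h x.
Proof.
move=> mD fi gi hi.
have afi : mu.-integrable D (EFin \o (fun x => a * f x)).
  by apply: eq_integrable (integrableZl mD a fi).
have bgi : mu.-integrable D (EFin \o (fun x => b * g x)).
  by apply: eq_integrable (integrableZl mD b gi).
have abi : mu.-integrable D (EFin \o (fun x => a * f x + b * g x)).
  by apply: eq_integrable (integrableD mD afi bgi).
split; first by apply: eq_integrable (integrableD mD abi hi).
by rewrite RintegralD// RintegralD// !RintegralZl.
Qed.

Lemma cintegral_linear D f g c : measurable D ->
  cintegrable D f -> cintegrable D g ->
  cintegrable D (fun x => c * f x + g x) /\
  cintegral mu D (fun x => c * f x + g x) =
    c * cintegral mu D f + cintegral mu D g.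
Proof.
move=> mD [fR fI] [gR gI]; case: c => a b.
have [iR eR] := Rintegral_lin3 a (- b) mD fR fI gR.
have [iI eI] := Rintegral_lin3 a b mD fI fR gI.
have re x : complex.Re ((a +i* b) * f x + g x) =
    a * complex.Re (f x) + - b * complex.Im (f x) + complex.Re (g x).
  by case: (f x) (g x) => ? ? [? ?] /=; rewrite mulNr.
have im x : complex.Im ((a +i* b) * f x + g x) =
    a * complex.Im (f x) + b * complex.Re (f x) + complex.Im (g x).
  by case: (f x) (g x) => ? ? [? ?].
split.
  split; [apply: eq_integrable iR|apply: eq_integrable iI] => // x _ /=;
  by rewrite ?re ?im.
rewrite /cintegral; under eq_Rintegral do rewrite re.
under [X in _ +i* X]eq_Rintegral do rewrite im.
by rewrite eR eI; apply/eqP; rewrite eq_complex /= mulNr !eqxx.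
Qed.

Lemma cintegrable0 D : cintegrable D (fun=> 0).
Proof. by split; exact: integrable0. Qed.

Lemma cintegral0 D : measurable D -> cintegral mu D (fun=> 0) = 0.
Proof. by move=> mD; rewrite /cintegral/= !Rintegral_cst// !mul0r. Qed.

Lemma cintegral_sum D (I : Type) (s : seq I) (c : I -> C) (F : I -> Qp -> C) :
  measurable D -> (forall i, cintegrable D (F i)) ->
  cintegrable D (fun x => \sum_(i <- s) c i * F i x) /\
  cintegral mu D (fun x => \sum_(i <- s) c i * F i x) =
    \sum_(i <- s) c i * cintegral mu D (F i).
Proof.
move=> mD Fi; elim: s => [|i s [IHi IHe]].
  split; first by apply: eq_cintegrable (cintegrable0 D) => // x _; rewrite big_nil.
  by rewrite big_nil -[RHS](cintegral0 mD); apply: eq_cintegral => x _; rewrite big_nil.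
have [li le] := cintegral_linear (c i) mD (Fi i) IHi.
split.
  by apply: eq_cintegrable li => // x _; rewrite big_cons.
rewrite big_cons -IHe -le; apply: eq_cintegral => x _.
by rewrite big_cons.
Qed.

Lemma cintegralZ D c f : measurable D -> cintegrable D f ->
  cintegrable D (fun x => c * f x) /\
  cintegral mu D (fun x => c * f x) = c * cintegral mu D f.
Proof.
move=> mD fi; have [li le] := cintegral_linear c mD fi (cintegrable0 D).
rewrite cintegral0// addr0 in le; rewrite -le.
split; last by apply: eq_cintegral => x _; rewrite addr0.
by apply: eq_cintegrable li => // x _; rewrite addr0.
Qed.

Lemma cintegral_cst D f c : measurable D -> (mu D < +oo)%E ->
  (forall x, D x -> f x = c) ->
  cintegrable D f /\ cintegral mu D f = c * (fine (mu D))%:C.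
Proof.
move=> mD Doo fc; have ci r : mu.-integrable D (EFin \o (fun=> r : R)).
  apply: measurable_bounded_integrable => //.
  by exists `|r|; split => // M rM x _ /=; exact: ltW.
split.
  apply: (@eq_cintegrable _ (fun=> c)) => //.
  by move=> x /fc.
rewrite (eq_cintegral fc) /cintegral !Rintegral_cst//.
by case: c {fc} => a b; apply/eqP; rewrite eq_complex /= !mulr0 subr0 add0r !eqxx.
Qed.

Lemma cintegral_setU D A f : measurable D -> measurable A ->
  cintegrable (D `|` A) f -> [disjoint D & A] ->
  cintegral mu (D `|` A) f = cintegral mu D f + cintegral mu A f.
Proof.
by move=> mD mA [fR fI] DA; rewrite /cintegral !Rintegral_setU.
Qed.

Hypothesis mu_haar : normalized_haar mu.

Lemma haar_padic_coset a m : mu (padic_coset a m) = mu (pball m).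
Proof.
rewrite -(mu_haar.1 a (pball m))//; congr (mu _); apply/seteqP; split=> x.
  by move=> xm; exists (x - a) => //; rewrite addrC subrK.
by move=> [y ym <-]; rewrite /padic_coset/= addrAC subrr add0r.
Qed.

Lemma haar_pball_cosets N K :
  mu (pball N) = ((p ^ K)%:R%:E * mu (pball (N - K%:Z)))%E.
Proof.
rewrite {1}(pball_cosets N K) measure_semi_additive_ord//; last 2 first.
- exact: trivIset_cosets.
- by rewrite -pball_cosets.
rewrite (eq_bigr (fun=> mu (pball (N - K%:Z)))); last first.
  by move=> j _; exact: haar_padic_coset.
by rewrite sumr_const card_ord mule_natl.
Qed.

Lemma haar_pball N : mu (pball N) = (p%:R ^ N)%:E.
Proof.
have [k [->|->]] : exists k : nat, N = k%:Z \/ N = - k%:Z.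
  by exists `|N|%N; lia.
  by rewrite (haar_pball_cosets _ k) subrr mu_haar.2 mule1 natrX.
have := haar_pball_cosets 0 k; rewrite mu_haar.2 sub0r natrX.
have pk : 0 < p%:R ^+ k :> R by rewrite exprn_gt0.
have : (0 <= mu (pball (- k%:Z) : set Qp))%E by [].
(* Finiteness of mu(B_{-k}) is not known beforehand: an infinite value would make mu(B_0) infinite,
   and a finite one is solved from p^k r = 1. *)
case: (mu _) => [r _| _|//].
  rewrite -EFinM => -[e]; congr (_%:E).
  by apply: (mulfI (lt0r_neq0 pk)); rewrite -e -exprnN divff// gt_eqF.
by rewrite gt0_muley ?lte_fin.
Qed.

Lemma haar_padic_coset_pow a m : mu (padic_coset a m) = (p%:R ^ m)%:E.
Proof. by rewrite haar_padic_coset haar_pball. Qed.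

(** Preimages are unions of cosets, hence open and measurable; the sum of the absolute values at the
    representatives bounds f. Each coset then contributes its value times the measure p^(N-K). *)
Lemma Rintegral_step N K (f : Qp -> R) :
  (forall x h, x \in B N -> h \in B (N - K%:Z) -> f (x + h) = f x) ->
  mu.-integrable (pball N) (EFin \o f) /\
  \int[mu]_(x in pball N) f x =
    p%:R ^ (N - K%:Z) * \sum_(j < p ^ K) f (j%:R * P ^ (- N)).
Proof.
move=> fK.
have fj j x : padic_coset (j%:R * P ^ (- N)) (N - K%:Z) x -> f x = f (j%:R * P ^ (- N)).
  by move=> xj; rewrite -(fK _ _ (padic_ball_rep _ _ _) xj) addrC subrK.
have mf : measurable_fun (pball N) f.
  move=> _ Y mY; apply: padic_open_measurable; apply: (@padic_openP _ _ _ (N - K%:Z)).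
  move=> x h [xN Yx] hN; split; last by rewrite /= fK.
  by rewrite /pball/= rpredD//; apply: padic_ball_le hN; lia.
split.
  apply: measurable_bounded_integrable => //.
    by rewrite haar_pball ltry.
  exists (\sum_(j < p ^ K) `|f (j%:R * P ^ (- N))|); split.
    exact: num_real.
  move=> M lM x xN.
  have [j jK xj] := padic_ball_approx K xN.
  rewrite /= (fj j)// (le_trans _ (ltW lM))// (bigD1 (Ordinal jK))//= lerDl.
  by rewrite sumr_ge0.
rewrite /Rintegral {1}(pball_cosets N K) integral_bigsetU_EFin//; last 3 first.
- exact: index_enum_uniq.
- exact: trivIset_cosets.
- by rewrite -pball_cosets; exact/measurable_realfun.measurable_EFinP.
under eq_bigr => j _.
  rewrite (eq_integral (cst (f (j%:R * P ^ (- N)))%:E)); last first.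
    by move=> x; rewrite inE => /fj ->.
  rewrite integral_cst// haar_padic_coset_pow -EFinM mulrC.
  over.
by rewrite sumEFin /= -mulr_sumr.
Qed.

Lemma cintegral_step N K f :
  (forall x h, x \in B N -> h \in B (N - K%:Z) -> f (x + h) = f x) ->
  cintegrable (pball N) f /\
  cintegral mu (pball N) f =
    (p%:R ^ (N - K%:Z))%:C * \sum_(j < p ^ K) f (j%:R * P ^ (- N)).
Proof.
move=> fK.
have [|iR eR] := @Rintegral_step N K (fun x => complex.Re (f x)).
  by move=> x h xN hN; rewrite fK.
have [|iI eI] := @Rintegral_step N K (fun x => complex.Im (f x)).
  by move=> x h xN hN; rewrite fK.
split=> //; rewrite /cintegral eR eI.
rewrite -(raddf_sum (@complex.Re R)) -(raddf_sum (@complex.Im R)).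
by case: (\sum_(_ < _) _) => a b; apply/eqP; rewrite eq_complex /= !mul0r subr0 addr0 !eqxx.
Qed.

(** For K large, B_{N-K} xi lies in Z_p, so the integrand is a step function and its integral is a
    multiple of the geometric sum [sum_chi] at p^{-N} xi. *)
Lemma cintegral_chi N xi :
  cintegrable (pball N) (fun x => chi (x * xi)) /\
  cintegral mu (pball N) (fun x => chi (x * xi)) =
    if xi \in B (- N) then (p%:R ^ N)%:C else 0.
Proof.
have [n xin] := padic_ball_ex xi; pose K := (`|N| + n)%N.
have xiK : xi \in B (K%:Z - N) by apply: padic_ball_le xin; rewrite /K; lia.
have [|i ->] := @cintegral_step N K (fun x => chi (x * xi)).
  move=> x h _ hK; apply: chi_eq; rewrite -mulrBl addrAC subrr add0r.
  by have := padic_ballM hK xiK; rewrite addrA subrK subrr.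
split=> //; under eq_bigr do rewrite -mulrA.
have PK : P ^ (- N) * xi \in B K%:Z.
  by rewrite mulrC padic_ballZ; apply: padic_ball_le xiK; lia.
rewrite sum_chi// [_ * xi]mulrC padic_ballZ sub0r.
case: ifP => _; last by rewrite mulr0.
rewrite -(rmorph_nat (@real_complex R)) -rmorphM /= natrX -[_ ^+ K]/(_ ^ K%:Z).
by rewrite -expfzDr// subrK.
Qed.

End HaarIntegral.

(** * The symbol, computed sphere by sphere *)

Section Symbol.
Variables (R : realType) (p : nat) (p_pr : prime p).
Local Notation Qp := (padic p_pr).
Local Notation C := R[i].
Local Notation B := (padic_ball p_pr).
Local Notation chi := (@chi R p p_pr).
Variable mu : {measure set Qp -> \bar R}.
Hypothesis mu_haar : normalized_haar mu.
Variable alpha : R.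
Hypothesis alpha_gt0 : 0 < alpha.
Implicit Types (x y xi eta : Qp) (M N : int) (k n K : nat).
Local Notation A := (p%:R `^ alpha : R).

Let p_gt0 : (0 : R) < p%:R. Proof. by rewrite ltr0n prime_gt0. Qed.
Let p_neq0 : (p%:R : R) != 0. Proof. by rewrite gt_eqF. Qed.
Let p_gt1 : (1 : R) < p%:R. Proof. by rewrite ltr1n prime_gt1. Qed.
Lemma powR_prime_gt1 : 1 < A.
Proof.
have := gt0_ltr_powR alpha_gt0 _ _ p_gt1.
by rewrite powR1; apply; rewrite nnegrE ?ler01// ltW.
Qed.
Local Notation A_gt1 := powR_prime_gt1.
Let A_gt0 : 0 < A. Proof. exact: lt_trans A_gt1. Qed.
Let A_neq0 : A != 0. Proof. by rewrite gt_eqF. Qed.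
Let Ap_gt1 : 1 < A * p%:R.
Proof. by rewrite (lt_trans A_gt1)// ltr_pMr. Qed.
Let Ap1_neq0 : A * p%:R - 1 != 0.
Proof. by rewrite subr_eq0 gt_eqF. Qed.

(** Turns real exponents into integer powers of p^r, so that the identities between lambda, the
    constant and the symbol become rational in p and p^alpha and are closed by [field]. *)
Lemma powR_pabs (r : R) y M : padic_abs y = p%:R ^ M ->
  pabs R y `^ r = (p%:R `^ r) ^ M.
Proof.
move=> yM; have -> : pabs R y = p%:R `^ M%:~R.
  rewrite /pabs yM powR_intmul ?ltW//; case: (M) => n.
    by rewrite rmorphXn /= ratr_nat.
  by rewrite NegzE -!exprnN fmorphV rmorphXn /= ratr_nat.
by rewrite -powRrM mulrC powRrM powR_intmul// powR_ge0.
Qed.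

Lemma eq_powR_pabs (r : R) x y : padic_abs x = padic_abs y ->
  pabs R x `^ r = pabs R y `^ r.
Proof. by rewrite /pabs => ->. Qed.

Lemma powR_p_alpha1 : p%:R `^ (alpha + 1) = A * p%:R.
Proof. by rewrite powRD ?p_neq0 ?implybT// powRr1// ltW. Qed.

Lemma lambdaE N :
  lambda p N alpha = (p%:R - 1) / (A * p%:R - 1) * A * A ^ (- N).
Proof.
rewrite /lambda powR_p_alpha1 powRrM powR_intmul ?powR_ge0//.
by rewrite expfzDr// expr1z mulrA.
Qed.

Lemma vlad_constE : vlad_const p alpha = (1 - A) / (1 - (A * p%:R)^-1).
Proof. by rewrite /vlad_const -opprD powRN powR_p_alpha1. Qed.

Local Notation W y := ((pabs R y `^ (- alpha - 1))%:C).

Lemma vlad_weight M y : padic_abs y = p%:R ^ M -> W y = ((A * p%:R) ^ (- M))%:C.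
Proof.
move=> yM; rewrite (powR_pabs _ yM) -opprD powRN powR_p_alpha1.
by rewrite -invr_expz exprz_inv -invr_expz.
Qed.

(** On B_{N-K} the factor chi - 1 is zero and absorbs the singular weight; off it a shift by B_{N-K}
    changes neither the absolute value nor the character. The product is therefore a step
    function. *)
Lemma symbol_integrable N xi :
  cintegrable mu (pball N) (fun y => W y * (chi (y * xi) - 1)).
Proof.
have [n xin] := padic_ball_ex xi; pose K := (`|N| + n)%N.
have xiK : xi \in B (K%:Z - N) by apply: padic_ball_le xin; rewrite /K; lia.
have chi1 h : h \in B (N - K%:Z) -> chi (h * xi) = 1.
  move=> hK; apply: chi_ball0.
  by have := padic_ballM hK xiK; rewrite addrA subrK subrr.
apply: (@cintegral_step _ _ _ _ mu_haar N K _ _).1 => x h _ hK.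
rewrite mulrDl chiD (chi1 h)// mulr1.
have [xK|xK] := boolP (x \in B (N - K%:Z)).
  have -> : chi (x * xi) - 1 = 0 by apply/eqP; rewrite subr_eq0 chi1.
  by rewrite [LHS]mulr0 [RHS]mulr0.
have e : padic_abs (x + h) = padic_abs x.
  symmetry; apply: (padic_absB_eq _ xK).
  by rewrite opprD addrA subrr sub0r rpredN.
by rewrite (eq_powR_pabs (- alpha - 1) e).
Qed.

Lemma symbol_ball N xi : xi \in B (- N) -> symbol mu N alpha xi = 0.
Proof.
move=> xiN; rewrite /symbol (@eq_cintegral _ _ _ _ _ _ (fun=> 0)).
  by rewrite cintegral0 ?mulr0//; exact: measurable_pball.
move=> y yN; rewrite chi_ball0 ?subrr ?mulr0//.
by have := padic_ballM yN xiN; rewrite subrr.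
Qed.

Lemma cintegral_sphere N (f : Qp -> C) : cintegrable mu (pball (N + 1)) f ->
  cintegral mu (pball (N + 1)) f =
    cintegral mu (pball N) f + cintegral mu (pball (N + 1) `\` pball N) f.
Proof.
have sub : (pball N : set Qp) `<=` pball (N + 1).
  by move=> x; apply: padic_ball_le; clear; lia.
have e : (pball (N + 1) : set Qp) = pball N `|` (pball (N + 1) `\` pball N).
  by rewrite setDUK.
move=> fi; rewrite {1}e cintegral_setU.
- by [].
- exact: measurable_pball.
- by apply: measurableD; exact: measurable_pball.
- by rewrite -e.
by apply/disj_set2P/seteqP; split=> // x [xN [_]].
Qed.

Lemma cintegral_chi_sub1 N xi :
  cintegrable mu (pball N) (fun y => chi (y * xi) - 1) /\
  cintegral mu (pball N) (fun y => chi (y * xi) - 1) =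
    ((if xi \in B (- N) then p%:R ^ N else 0) - p%:R ^ N)%:C.
Proof.
have mN : measurable (pball N : set Qp) := @measurable_pball p p_pr N.
have [chii chie] := cintegral_chi mu_haar N xi.
have [onei onee] : cintegrable mu (pball N) (fun=> 1) /\
    cintegral mu (pball N) (fun=> 1) = 1 * (fine (mu (pball N)))%:C.
  by apply: cintegral_cst => //; rewrite haar_pball// ltry.
have [li le] := cintegral_linear (-1) mN onei chii.
have e y : -1 * 1 + chi (y * xi) = chi (y * xi) - 1.
  by rewrite mulr1 addrC.
split; first by apply: eq_cintegrable li.
transitivity (cintegral mu (pball N) (fun y => -1 * 1 + chi (y * xi))).
  by apply: eq_cintegral => y _; rewrite e.
rewrite le onee chie haar_pball//= mul1r mulN1r addrC.
by case: ifP => _; rewrite ?rmorphB ?rmorphN ?add0r ?sub0r ?rmorphN.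
Qed.

(** The weight is constant on the sphere between B_N and B_{N+1}, so the increment is that constant
    times the difference of the integrals of chi - 1 over the two balls. *)
Lemma symbolS N xi : symbol mu (N + 1) alpha xi = symbol mu N alpha xi +
  (vlad_const p alpha * ((A * p%:R) ^ (- (N + 1)) *
   (((if xi \in B (- (N + 1)) then p%:R ^ (N + 1) else 0) - p%:R ^ (N + 1)) -
    ((if xi \in B (- N) then p%:R ^ N else 0) - p%:R ^ N))))%:C.
Proof.
rewrite /symbol cintegral_sphere; last exact: symbol_integrable.
rewrite mulrDr; congr (_ + _); rewrite [RHS]rmorphM; congr (_ * _).
have mS : measurable (pball (N + 1) `\` pball N : set Qp).
  by apply: measurableD; exact: measurable_pball.
have [chii chie] := cintegral_chi_sub1 (N + 1) xi.
have := cintegral_sphere chii; rewrite chie (cintegral_chi_sub1 N xi).2 => h.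
rewrite [RHS]rmorphM [X in _ = _ * X]rmorphB /= h [X in _ * (X - _)]addrC addrK.
have si : cintegrable mu (pball (N + 1) `\` pball N) (fun y => chi (y * xi) - 1).
  have mN := @measurable_pball p p_pr (N + 1).
  have [iR iI] := chii.
  by split; [apply: integrableS iR|apply: integrableS iI] => //;
    exact: subDsetl.
rewrite -(cintegralZ _ mS si).2; apply: eq_cintegral => y [yN1 /negP yN].
have [M NM yM] := padic_notin_ball yN.
rewrite (vlad_weight yM); congr ((_ ^ (- _))%:C * _).
by move: yN1; rewrite /pball/= unfold_in yM ler_eXz2l ?ltr1n ?prime_gt1//; clear -NM; lia.
Qed.

(** The value on B_{-N} cannot be |xi|_p^alpha, which would depend on the representative of the
    trivial coset. *)
Definition vlad_eig N xi : R :=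
  if xi \in B (- N) then lambda p N alpha else pabs R xi `^ alpha.

(** For |xi|_p = p^M the proof is an induction on the radius N above -M, with xi fixed: the
    character is trivial on B_{-M}, so the symbol starts from 0 there. *)
Lemma symbolE N xi :
  symbol mu N alpha xi = (vlad_eig N xi - lambda p N alpha)%:C.
Proof.
rewrite /vlad_eig; case: ifPn => [xiN|xiN]; first by rewrite symbol_ball// subrr.
have [M NM xiM] := padic_notin_ball xiN.
rewrite (powR_pabs _ xiM) -/A.
have xiB k : (xi \in B (- (- M + k%:Z))) = (k == 0%N).
  by rewrite unfold_in xiM ler_eXz2l ?ltr1n ?prime_gt1//; clear; lia.
have [k ->] : exists k, N = - M + k.+1%:Z by exists (absz (N + M)).-1; clear -NM; lia.
have qS (x : R) (m : int) : x != 0 -> x ^ (m + 1) = x ^ m * x.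
  by move=> x0; rewrite expfzDr// expr1z.
elim: k => [|k IHk].
  (* Only the first sphere outside B_{-M} contributes, and it alone produces the term p^(alpha
     M). *)
  rewrite -[1%:Z]/(0%:Z + 1%:Z) addrA symbolS -addrA !xiB addr0 symbol_ball; last first.
    by rewrite opprK unfold_in xiM.
  rewrite add0r; congr (_%:C); rewrite eqxx subrr subr0 /= add0r.
  rewrite lambdaE vlad_constE.
  have -> : A ^ M = A ^ (- (- M + 1)) * A.
    by rewrite -qS//; congr (_ ^ _); clear; lia.
  rewrite -!invr_expz !qS ?mulf_neq0// !expfzMl.
  set q := p%:R ^ (- M); set t := A ^ (- M).
  have q0 : q != 0 by rewrite expfz_neq0.
  have t0 : t != 0 by rewrite expfz_neq0.
  by field; rewrite q0 t0 p_neq0 A_neq0 Ap1_neq0.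
(* From here on both indicators vanish, and the increment is exactly the difference of the lambdas
   for two consecutive radii. *)
have eS : - M + k.+2%:Z = (- M + k.+1%:Z) + 1 by clear; lia.
have := xiB k.+2; rewrite eS => xiBS; rewrite symbolS IHk xiB xiBS.
rewrite /= -rmorphD; congr (_%:C); set N' := - M + k.+1%:Z.
rewrite !lambdaE vlad_constE -!invr_expz !qS ?mulf_neq0// !expfzMl.
set q := p%:R ^ N'; set t := A ^ N'.
have q0 : q != 0 by rewrite expfz_neq0.
have t0 : t != 0 by rewrite expfz_neq0.
by field; rewrite q0 t0 p_neq0 A_neq0 Ap1_neq0.
Qed.

End Symbol.

(** * The integral of |x|_p^alpha over a ball *)

Section PowerIntegral.
Variables (R : realType) (p : nat) (p_pr : prime p).
Local Notation Qp := (padic p_pr).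
Local Notation B := (padic_ball p_pr).
Variable mu : {measure set Qp -> \bar R}.
Hypothesis mu_haar : normalized_haar mu.
Variable alpha : R.
Hypothesis alpha_gt0 : 0 < alpha.
Implicit Types (x y : Qp) (M N : int) (k : nat).
Local Notation A := (p%:R `^ alpha : R).

Let p_gt0 : (0 : R) < p%:R. Proof. by rewrite ltr0n prime_gt0. Qed.
Let p_neq0 : (p%:R : R) != 0. Proof. by rewrite gt_eqF. Qed.
Let p_gt1 : (1 : R) < p%:R. Proof. by rewrite ltr1n prime_gt1. Qed.
Let A_gt1 : 1 < A. Proof. exact: powR_prime_gt1. Qed.
Let A_gt0 : 0 < A. Proof. exact: lt_trans A_gt1. Qed.
Let A_neq0 : A != 0. Proof. by rewrite gt_eqF. Qed.
Let Ap_gt1 : 1 < A * p%:R.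
Proof. by rewrite (lt_trans A_gt1)// ltr_pMr. Qed.
Let Ap1_neq0 : A * p%:R - 1 != 0.
Proof. by rewrite subr_eq0 gt_eqF. Qed.
Let mB N : measurable (pball N : set Qp) := @measurable_pball p p_pr N.

(** Away from 0 the absolute value is locally constant: the open ball of radius |x|_p around x stays
    on the sphere of x. *)
Lemma padic_radial_open (S : set Qp) :
  (forall x y, S x -> padic_abs y = padic_abs x -> S y) -> ~ S 0 -> open S.
Proof.
move=> Sr S0; change (@padic_open p p_pr S) => x Sx.
have [x0|[M xM]] := padic_abs_cases x; first by move: Sx; rewrite x0.
exists (padic_abs x); first by rewrite xM exprz_gt0// ltr0n prime_gt0.
move=> y /= yx; apply: (Sr x) => //; symmetry; apply: (@padic_absB_eq _ _ _ _ (M - 1)).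
  have [xy0|[L xyL]] := padic_abs_cases (x - y); first by rewrite xy0 rpred0.
  move: yx; rewrite -padic_absN opprB xyL xM ltr_eXz2l ?ltr1n ?prime_gt1// => LM.
  by rewrite unfold_in xyL ler_eXz2l ?ltr1n ?prime_gt1//; clear -LM; lia.
by rewrite unfold_in xM ler_eXz2l ?ltr1n ?prime_gt1//; clear; lia.
Qed.

(** Either the set or its complement misses 0 and is open. This replaces the step-function argument,
    which fails for |x|_p^alpha at 0. *)
Lemma padic_radial_measurable (S : set Qp) :
  (forall x y, S x -> padic_abs y = padic_abs x -> S y) -> measurable S.
Proof.
move=> Sr; have [S0|S0] := pselect (S 0); last first.
  by apply: padic_open_measurable; exact: padic_radial_open.
rewrite -[S]setCK; apply: measurableC; apply: padic_open_measurable.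
apply: padic_radial_open => [x y|]; last by apply; exact: S0.
by move=> Sx xy Sy; apply: Sx; apply: (Sr y).
Qed.

Let g x : R := pabs R x `^ alpha.

Let g_le M x : x \in B M -> g x <= A ^ M.
Proof.
move=> xM; rewrite /g; have [->|[L xL]] := padic_abs_cases x.
  by rewrite /pabs padic_abs0 rmorph0 powR0 ?gt_eqF// exprz_ge0// ltW.
rewrite (powR_pabs _ xL) ler_eXz2l//.
by move: xM; rewrite unfold_in xL ler_eXz2l ?ltr1n ?prime_gt1.
Qed.

Lemma integrable_pabs_powR M : mu.-integrable (pball M) (EFin \o g).
Proof.
apply: measurable_bounded_integrable => //.
- by rewrite haar_pball// ltry.
- move=> _ Y mY; apply: padic_radial_measurable => x y [xM Yx] yx; split.
    by move: xM; rewrite /pball/= !unfold_in yx.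
  by rewrite /= /g (eq_powR_pabs _ yx).
exists (A ^ M); split; first exact: num_real.
move=> L ML x xM; rewrite /= ger0_norm ?powR_ge0//.
exact: le_trans (g_le xM) (ltW ML).
Qed.

Let I_ M := \int[mu]_(x in pball M) g x.

Let I_S M : I_ (M + 1) = I_ M + A ^ (M + 1) * (p%:R ^ (M + 1) - p%:R ^ M).
Proof.
pose S : set Qp := pball (M + 1) `\` pball M.
have sub : (pball M : set Qp) `<=` pball (M + 1).
  by move=> x; apply: padic_ball_le; clear; lia.
have e : (pball (M + 1) : set Qp) = pball M `|` S by rewrite setDUK.
have mS : measurable S by apply: measurableD; exact: mB.
have dMS : [disjoint pball M & S].
  by apply/disj_set2P/seteqP; split=> // x [xN [_]].
have fS : fine (mu S) = p%:R ^ (M + 1) - p%:R ^ M.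
  have h : (mu (pball (M + 1)) = mu (pball M) + mu S)%E.
    by rewrite {1}e measureU//; apply/disj_set2P.
  rewrite !haar_pball// in h.
  by case: (mu S) h => // r [->] /=; rewrite addrAC subrr add0r.
rewrite /I_ {1}e Rintegral_setU//; last by rewrite -e; exact: integrable_pabs_powR.
congr (_ + _); rewrite -fS -Rintegral_cst//; apply: eq_Rintegral => x.
rewrite inE => -[xM1 /negP xM]; rewrite /g.
have [L ML xL] := padic_notin_ball xM; rewrite (powR_pabs _ xL); congr (_ ^ _).
by move: xM1; rewrite /pball/= unfold_in xL ler_eXz2l ?ltr1n ?prime_gt1//; clear -ML; lia.
Qed.

Let I_bound M : 0 <= I_ M <= (A * p%:R) ^ M.
Proof.
apply/andP; split; first by apply: Rintegral_ge0 => x _; exact: powR_ge0.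
have -> : (A * p%:R) ^ M = \int[mu]_(x in pball M) (fun=> A ^ M) x.
  by rewrite Rintegral_cst// haar_pball// expfzMl.
apply: le_Rintegral => //.
- exact: integrable_pabs_powR.
- apply: measurable_bounded_integrable => //.
    by rewrite haar_pball// ltry.
  by exists `|A ^ M|; split; [exact: num_real|move=> L ML x _ /=; exact: ltW].
by move=> x; exact: g_le.
Qed.

(* The difference d of the two sides is invariant under M |-> M - 1 by the
   recurrence on spheres, while both sides are O((p^alpha p)^M) as M -> -oo. *)
Lemma Rintegral_pabs_powR M :
  \int[mu]_(x in pball M) (pabs R x `^ alpha) = p%:R ^ M * lambda p (- M) alpha.
Proof.
pose J L := p%:R ^ L * lambda p (- L) alpha.
pose c := (p%:R - 1) / (A * p%:R - 1) * A.
have c_ge0 : 0 <= c.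
  by rewrite mulr_ge0 ?ltW// divr_gt0// subr_gt0.
have JE L : J L = c * (A * p%:R) ^ L.
  by rewrite /J lambdaE// opprK expfzMl /c; ring.
have qS (x : R) (m : int) : x != 0 -> x ^ (m + 1) = x ^ m * x.
  by move=> x0; rewrite expfzDr// expr1z.
have JS L : J (L + 1) = J L + A ^ (L + 1) * (p%:R ^ (L + 1) - p%:R ^ L).
  by rewrite !JE !expfzMl !qS// /c; field.
clearbody c.
have inv k : I_ M - J M = I_ (M - k%:Z) - J (M - k%:Z).
  elim: k => [|k ->]; first by rewrite subr0.
  have -> : M - k%:Z = (M - k.+1%:Z) + 1 by clear; lia.
  by rewrite I_S JS; ring.
apply/eqP; rewrite -subr_eq0 -/(I_ M) -/(J M); apply/negPn/negP => d0.
set d := I_ M - J M in d0 inv.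
have bound k : `|d| * (A * p%:R) ^+ k <= (1 + c) * (A * p%:R) ^ M.
  rewrite (inv k) JE -[_ ^+ k]/(_ ^ k%:Z) -ler_pdivlMr ?exprz_gt0 ?mulr_gt0//.
  rewrite invr_expz -mulrA -expfzDr ?mulf_neq0//.
  have /andP[I0 Ib] := I_bound (M - k%:Z).
  rewrite (le_trans (ler_normB _ _))// mulrDl mul1r !ger0_norm ?lerD//.
  by rewrite mulr_ge0// exprz_ge0// mulr_ge0 ?ltW.
(* If d were nonzero, [bound] would give k <= (p^alpha p)^k <= e for every k, against the
   Archimedean property. *)
pose e := (1 + c) * (A * p%:R) ^ M / `|d|.
have e_ge0 : 0 <= e.
  by rewrite divr_ge0// mulr_ge0 ?addr_ge0// exprz_ge0// mulr_ge0// ltW.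
have := archi_boundP e_ge0; set k := Num.bound _; rewrite ltNge => /negP; apply.
rewrite /e ler_pdivlMr ?normr_gt0// mulrC (le_trans _ (bound k))// ler_wpM2l//.
have : (k%:R : R) <= p%:R ^+ k.
  by rewrite -natrX ler_nat ltnW// ltn_expl// prime_gt1.
move=> /le_trans; apply; rewrite exprMn ler_peMl//.
by rewrite exprn_ege1// ltW.
Qed.

Lemma cintegral_pabs_powR M :
  cintegrable mu (pball M) (fun x => (pabs R x `^ alpha)%:C) /\
  cintegral mu (pball M) (fun x => (pabs R x `^ alpha)%:C) =
    (p%:R ^ M * lambda p (- M) alpha)%:C.
Proof.
split; last first.
  by rewrite /cintegral/= Rintegral_pabs_powR Rintegral_cst// mul0r.
by split; [exact: integrable_pabs_powR|exact: integrable0].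
Qed.

End PowerIntegral.

(** * Finite sums of characters on B_N and the action of the operators on them *)

Section TrigonometricSums.
Variables (R : realType) (p : nat) (p_pr : prime p).
Local Notation Qp := (padic p_pr).
Local Notation C := R[i].
Local Notation B := (padic_ball p_pr).
Local Notation P := (p%:R : Qp).
Local Notation chi := (@chi R p p_pr).
Implicit Types (x y xi eta : Qp) (M N : int) (k n K : nat) (u v phi : Qp -> C).

(** The element k p^(N-K). For k < p^K these represent B_{K-N} modulo B_{-N}, that is, the
    characters of B_N trivial on B_{N-K}. *)
Definition dual_rep N K k : Qp := k%:R * P ^ (- (K%:Z - N)).

Definition trig_on N K (d : 'I_(p ^ K) -> C) u :=
  forall x, x \in B N -> u x = \sum_(k < p ^ K) d k * chi (x * dual_rep N K k).

Lemma dual_rep_ball N K k : dual_rep N K k \in B (K%:Z - N).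
Proof. exact: padic_ball_rep. Qed.

Lemma dual_rep_inj N K (i j : 'I_(p ^ K)) :
  dual_rep N K i - dual_rep N K j \in B (- N) -> i = j.
Proof.
move=> ij; apply: val_inj.
apply: (@padic_ball_rep_inj _ p_pr _ _ (K%:Z - N) K); [exact: ltn_ord..|].
by apply: padic_ball_le ij; clear; lia.
Qed.

(** The coefficients are the discrete Fourier transform of the values u(j p^{-N}). After exchanging
    the sums, [sum_chi] keeps only the index j of the coset containing x. *)
Lemma trig_on_ex N K u : (forall x h, h \in B (N - K%:Z) -> u (x + h) = u x) ->
  exists d : 'I_(p ^ K) -> C, trig_on N d u.
Proof.
move=> uK; pose r (j : nat) := j%:R * P ^ (- N).
have pK0 : (p ^ K)%:R != 0 :> C.
  by rewrite pnatr_eq0 -lt0n expn_gt0 prime_gt0.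
exists (fun k => (p ^ K)%:R^-1 *
  \sum_(j < p ^ K) u (r j) * chi (- (r j * dual_rep N K k))) => x xN.
have [i iK xi] := padic_ball_approx K xN; rewrite -/(r i) in xi.
have -> : u x = u (r i) by rewrite -(uK (r i) _ xi) [r i + _]addrC subrK.
under eq_bigr do rewrite -mulrA mulr_suml.
rewrite -mulr_sumr exchange_big /=.
have inner (j : 'I_(p ^ K)) :
    \sum_(k < p ^ K) u (r j) * chi (- (r j * dual_rep N K k)) *
      chi (x * dual_rep N K k) =
    u (r j) * (if val j == i then (p ^ K)%:R else 0).
  under eq_bigr => k _.
    rewrite -mulrA -chiD addrC -mulrBl /dual_rep mulrCA.
    over.
  rewrite -mulr_sumr; congr (_ * _).
  rewrite sum_chi padic_ballZ.
    have -> : 0 - (K%:Z - N) = N - K%:Z by clear; lia.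
    congr (if _ then _ else _); apply/idP/eqP => [xj|->//].
    apply: (@padic_ball_rep_inj _ p_pr _ _ N K) => //; first exact: ltn_ord.
    by have := rpredB xi xj; rewrite opprB addrC addrA subrK.
  have -> : K%:Z - (K%:Z - N) = N by clear; lia.
  by rewrite rpredB ?padic_ball_rep.
under eq_bigr do rewrite inner.
rewrite (bigD1 (Ordinal iK))//= eqxx big1 ?addr0.
  by rewrite mulrCA mulVf ?mulr1.
move=> j ji; case: eqP => [e|_]; last exact: mulr0.
by move/eqP: ji; case; exact: val_inj.
Qed.

(** The frequencies lie in B_{K-N}, so each character is invariant under B_{N-K}. This is how
    D^alpha_N is seen to preserve D(B_N). *)
Lemma trig_on_test N K (d : 'I_(p ^ K) -> C) u : (forall x, x \notin B N -> u x = 0) ->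
  trig_on N d u -> test_function_on N u.
Proof.
move=> u0 du; apply/test_function_onP; split=> //; exists K => x h hK.
have hN : h \in B N by apply: padic_ball_le hK; clear; lia.
have [xN|xN] := boolP (x \in B N).
  have xhN : x + h \in B N by exact: rpredD.
  rewrite (du _ xN) (du _ xhN); apply: eq_bigr => k _; congr (_ * _).
  apply: chi_eq; rewrite -mulrBl addrAC subrr add0r.
  have := padic_ballM hK (dual_rep_ball N K k).
  by have -> : N - K%:Z + (K%:Z - N) = 0 by clear; lia.
by rewrite !u0//; apply: contra xN => xhN; rewrite -(addrK h x) rpredB.
Qed.

Variable mu : {measure set Qp -> \bar R}.
Hypothesis mu_haar : normalized_haar mu.
Let mB N : measurable (pball N : set Qp) := @measurable_pball p p_pr N.

Lemma cintegral_chi_trig N K (d : 'I_(p ^ K) -> C) u xi : trig_on N d u ->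
  cintegral mu (pball N) (fun x => chi (x * xi) * u x) =
  \sum_(k < p ^ K) d k *
    (if dual_rep N K k + xi \in B (- N) then (p%:R ^ N)%:C else 0).
Proof.
move=> du; pose F (k : 'I_(p ^ K)) x := chi (x * (dual_rep N K k + xi)).
have Fi (k : 'I_(p ^ K)) : cintegrable mu (pball N) (F k).
  exact: (cintegral_chi mu_haar N _).1.
transitivity (cintegral mu (pball N)
    (fun x => \sum_(k <- index_enum 'I_(p ^ K)) d k * F k x)).
  apply: eq_cintegral => x xN; rewrite du// mulr_sumr; apply: eq_bigr => k _.
  by rewrite mulrCA /F [x * (_ + _)]mulrDr chiD; set a := chi _; rewrite [a * _]mulrC.
rewrite (cintegral_sum _ d (mB N) Fi).2; apply: eq_bigr => k _.
by rewrite /F (cintegral_chi mu_haar N _).2.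
Qed.

Lemma fourier_trig N K (d : 'I_(p ^ K) -> C) u xi : (forall x, x \notin B N -> u x = 0) ->
  trig_on N d u -> fourier mu u xi =
  \sum_(k < p ^ K) d k *
    (if dual_rep N K k + xi \in B (- N) then (p%:R ^ N)%:C else 0).
Proof.
move=> u0 du; rewrite -(cintegral_chi_trig xi du); apply: cintegral_supp.
by move=> x /negP xN; rewrite u0// mulr0.
Qed.

Let pN_neq0 N : (p%:R ^ N)%:C != 0 :> C.
Proof.
rewrite fmorph_eq0 expfz_neq0//.
by rewrite pnatr_eq0 -lt0n prime_gt0.
Qed.

Let pNK N : (p%:R ^ (- N))%:C * (p%:R ^ N)%:C = 1 :> C.
Proof.
rewrite -rmorphM -invr_expz mulVf ?rmorph1//.
by have := pN_neq0 N; rewrite fmorph_eq0.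
Qed.

Lemma fourier_on_trig N K (d : 'I_(p ^ K) -> C) u (c : dual p_pr N) : trig_on N d u ->
  fourier_on mu u c =
  \sum_(k < p ^ K) d k * (dual_rep N K k + repr c \in B (- N))%:R.
Proof.
move=> du; rewrite /fourier_on (cintegral_chi_trig _ du) mulr_sumr.
apply: eq_bigr => k _; rewrite mulrCA; congr (_ * _).
by case: ifP => _; rewrite ?pNK ?mulr0.
Qed.

Lemma dual_repr_pi N xi : repr (\pi_(dual p_pr N) xi) - xi \in B (- N).
Proof. by rewrite Quotient.idealrBE reprK. Qed.

Lemma dual_pi_eq N xi eta : xi - eta \in B (- N) ->
  \pi_(dual p_pr N) xi = \pi_(dual p_pr N) eta.
Proof. by rewrite Quotient.idealrBE => /eqP. Qed.

(** At a common level M, the transform evaluated at the class of -xi_j isolates the j-th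
    coefficient. This injectivity identifies the function chosen by [fourier_on_inv]. *)
Lemma fourier_on_inj N u v : test_function_on N u -> test_function_on N v ->
  fourier_on (N := N) mu u = fourier_on mu v -> u = v.
Proof.
move=> /test_function_onP[u0 [K uK]] /test_function_onP[v0 [L vL]] uv.
pose M := maxn K L.
have [|d du] := @trig_on_ex N M u.
  by move=> x h hM; apply: uK; apply: padic_ball_le hM; rewrite /M; clear; lia.
have [|e ev] := @trig_on_ex N M v.
  by move=> x h hM; apply: vL; apply: padic_ball_le hM; rewrite /M; clear; lia.
have sub_mem (a b c : Qp) : a + c \in B (- N) -> b + c \in B (- N) ->
    a - b \in B (- N).
  by move=> ac bc; have := rpredB ac bc; rewrite opprD addrACA subrr addr0.
have coef w (f : 'I_(p ^ M) -> C) (j : 'I_(p ^ M)) : trig_on N f w ->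
    fourier_on mu w (\pi_(dual p_pr N) (- dual_rep N M j)) = f j.
  move=> fw; rewrite (fourier_on_trig _ fw).
  have rj := dual_repr_pi N (- dual_rep N M j).
  rewrite opprK addrC in rj; rewrite (bigD1 j)//= rj mulr1 big1 ?addr0//.
  move=> k kj; case: (boolP (_ \in _)) => [kB|_]; last exact: mulr0.
  case/eqP: kj; apply: (@dual_rep_inj N M).
  exact: (sub_mem _ _ _ kB rj).
apply/funext => x; have [xN|xN] := boolP (x \in B N); last by rewrite u0 ?v0.
rewrite (du x xN) (ev x xN); apply: eq_bigr => k _; congr (_ * _).
by rewrite -(coef _ _ k du) uv (coef _ _ k ev).
Qed.

Variable alpha : R.
Hypothesis alpha_gt0 : 0 < alpha.
Local Notation eig := (@vlad_eig R p p_pr alpha).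

Lemma vlad_eigN N xi : eig N (- xi) = eig N xi.
Proof. by rewrite /vlad_eig rpredN /pabs padic_absN. Qed.

Lemma vlad_eig_coset N xi eta : xi - eta \in B (- N) -> eig N xi = eig N eta.
Proof.
move=> xe; rewrite /vlad_eig.
have xeB : (xi \in B (- N)) = (eta \in B (- N)).
  apply/idP/idP => h; last by rewrite -(subrK eta xi) rpredD.
  by rewrite -(subKr xi eta) rpredB.
rewrite xeB.
have [eN|eN] := boolP (eta \in B (- N)); first by [].
have ex : eta - xi \in B (- N) by rewrite -rpredN opprB.
by rewrite (eq_powR_pabs alpha (padic_absB_eq ex eN)).
Qed.

(** Up to the factor p^N, G is the integrand of the inverse transform for the character of frequency
    eta cut off to B_N. On its support -eta + B_{-N} the factor chi(-(x xi)) equals chi(x eta),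
    leaving the integral of |xi|_p^alpha. *)
Lemma cintegral_chi_coset N eta x : x \in B N ->
  let G xi := if eta + xi \in B (- N) then
    chi (- (x * xi)) * (pabs R xi `^ alpha)%:C else 0 in
  cintegrable mu setT G /\
  cintegral mu setT G = (p%:R ^ (- N) * eig N eta)%:C * chi (x * eta).
Proof.
move=> xN G; pose D : set Qp := padic_coset (- eta) (- N).
have mD : measurable D by exact: measurable_padic_coset.
have muD : mu D = (p%:R ^ (- N))%:E by exact: haar_padic_coset_pow.
have DE xi : D xi <-> eta + xi \in B (- N).
  by rewrite /D /padic_coset/= opprK addrC.
have G0 xi : ~ D xi -> G xi = 0.
  by move=> /DE/negP/negbTE eN; rewrite /G eN.
suff [Gi Ge] : cintegrable mu D G /\
    cintegral mu D G = (p%:R ^ (- N) * eig N eta)%:C * chi (x * eta).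
  split; first exact: cintegrable_supp Gi.
  by rewrite (cintegral_supp _ G0).
have Gchi xi : D xi -> G xi = chi (x * eta) * (pabs R xi `^ alpha)%:C.
  move=> /DE eN; rewrite /G eN; congr (_ * _); apply: chi_eq.
  rewrite -opprD -mulrDr rpredN addrC.
  by have := padic_ballM xN eN; rewrite subrr.
(* The trivial coset is B_{-N} itself, where the power integral gives p^{-N} lambda; on any other
   coset |xi|_p = |eta|_p throughout. *)
have [eN|eN] := boolP (eta \in B (- N)).
  have DB : D = pball (- N).
    apply/seteqP; split=> [xi /DE h|xi h]; last by apply/DE; exact: rpredD.
    by rewrite /pball/= -(addKr eta xi) rpredD ?rpredN.
  have [gi ge] := cintegral_pabs_powR mu_haar alpha_gt0 (- N).
  have [li le] := cintegralZ (chi (x * eta)) (mB (- N)) gi.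
  rewrite DB in Gchi *; split.
    by apply: eq_cintegrable li => // xi /Gchi.
  by rewrite (eq_cintegral _ Gchi) le ge /vlad_eig eN opprK mulrC.
have Gcst xi : D xi -> G xi = chi (x * eta) * (pabs R eta `^ alpha)%:C.
  move=> Dxi; rewrite (Gchi xi Dxi).
  have xe : eta - (- xi) \in B (- N) by rewrite opprK; apply/DE.
  have e := padic_absB_eq xe eN; rewrite padic_absN in e.
  by rewrite (eq_powR_pabs alpha e).
have muDoo : (mu D < +oo)%E by rewrite muD ltry.
have [ci ce] := cintegral_cst mD muDoo Gcst; split=> //.
by rewrite ce muD /= /vlad_eig (negbTE eN) rmorphM /= mulrC mulrA mulrAC.
Qed.

Lemma vladimirov_trig N K (d : 'I_(p ^ K) -> C) u x : (forall x, x \notin B N -> u x = 0) ->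
  trig_on N d u -> x \in B N -> vladimirov mu alpha u x =
  \sum_(k < p ^ K) d k * (eig N (dual_rep N K k))%:C * chi (x * dual_rep N K k).
Proof.
move=> u0 du xN; rewrite /vladimirov /fourier_inv.
pose G (k : 'I_(p ^ K)) xi := if dual_rep N K k + xi \in B (- N) then
  chi (- (x * xi)) * (pabs R xi `^ alpha)%:C else 0.
have GP (k : 'I_(p ^ K)) := cintegral_chi_coset (dual_rep N K k) xN.
transitivity (cintegral mu setT (fun xi =>
    \sum_(k <- index_enum 'I_(p ^ K)) (d k * (p%:R ^ N)%:C) * G k xi)).
  apply: eq_cintegral => xi _; rewrite (fourier_trig _ u0 du) mulrA mulr_sumr.
  apply: eq_bigr => k _; rewrite /G mulrCA -mulrA; congr (_ * _).
  by case: ifP => _; rewrite ?mulr0// mulrC.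
rewrite (cintegral_sum _ _ measurableT (fun k : 'I_(p ^ K) => (GP k).1)).2.
apply: eq_bigr => k _; rewrite (GP k).2 rmorphM /= -!mulrA; congr (_ * _).
by rewrite mulrA [(_ ^ N)%:C * _]mulrC pNK mul1r.
Qed.

(** Since chi((x-y) xi) - chi(x xi) = chi(x xi) (chi(-y xi) - 1), each character is multiplied by
    the symbol at -xi, which is the eigenvalue minus lambda; the term lambda u(x) restores the
    eigenvalue. *)
Lemma cintegral_diff_trig N K (d : 'I_(p ^ K) -> C) u x : trig_on N d u -> x \in B N ->
  (lambda p N alpha)%:C * u x + (vlad_const p alpha)%:C *
    cintegral mu (pball N) (fun y =>
      (pabs R y `^ (- alpha - 1))%:C * (u (x - y) - u x)) =
  \sum_(k < p ^ K) d k * (eig N (dual_rep N K k))%:C * chi (x * dual_rep N K k).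
Proof.
move=> du xN.
pose F (k : 'I_(p ^ K)) y :=
  (pabs R y `^ (- alpha - 1))%:C * (chi (y * - dual_rep N K k) - 1).
have Fi (k : 'I_(p ^ K)) : cintegrable mu (pball N) (F k) by exact: symbol_integrable.
pose c (k : 'I_(p ^ K)) := d k * chi (x * dual_rep N K k).
have -> : cintegral mu (pball N) (fun y =>
      (pabs R y `^ (- alpha - 1))%:C * (u (x - y) - u x)) =
    cintegral mu (pball N) (fun y =>
      \sum_(k <- index_enum 'I_(p ^ K)) c k * F k y).
  apply: eq_cintegral => y yN; have xyN : x - y \in B N by exact: rpredB.
  rewrite (du _ xN) (du _ xyN) -sumrB mulr_sumr.
  apply: eq_bigr => k _; rewrite /c /F [RHS]mulrCA; congr (_ * _).
  by rewrite mulrN mulrBl chiD; set a := chi _; set b := chi _; ring.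
rewrite (cintegral_sum _ c (mB N) Fi).2 mulr_sumr (du _ xN) mulr_sumr -big_split /=.
apply: eq_bigr => k _.
have sk : (vlad_const p alpha)%:C * cintegral mu (pball N) (F k) =
    (eig N (dual_rep N K k) - lambda p N alpha)%:C.
  by rewrite -(vlad_eigN N (dual_rep N K k)) -(symbolE mu_haar).
rewrite [X in _ + X]mulrCA sk /c rmorphB /=.
by set a := chi _; ring.
Qed.

End TrigonometricSums.

(** * The representations of D^alpha_N and the symbol on the dual group *)

Theorem theorem1 (R : realType) (p : nat) (p_pr : prime p)
    (mu : {measure set (padic p_pr) -> \bar R}) (mu_haar : normalized_haar mu)
    (N : int) (alpha : R) (alpha_gt0 : 0 < alpha) :
  (forall phi : padic p_pr -> R[i], test_function_on N phi ->
     [/\ test_function_on N (vladimirov_on mu N alpha phi),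
         vladimirov_on mu N alpha phi = convolution N (f_distr mu N alpha) phi
       & forall x : padic p_pr, pball N x ->
           vladimirov_on mu N alpha phi x =
             (lambda p N alpha)%:C * phi x + (vlad_const p alpha)%:C *
               cintegral mu (pball N) (fun y =>
                 (pabs R y `^ (- alpha - 1))%:C * (phi (x - y) - phi x))])
  /\
  (exists P : dual p_pr N -> R[i],
     [/\ unique (fun Q : dual p_pr N -> R[i] =>
           forall xi : padic p_pr, (~` pball (- N) `|` [set 0]) xi ->
             Q (\pi_(dual p_pr N) xi) = symbol mu N alpha xi) P,
         forall xi : padic p_pr,
           P (\pi_(dual p_pr N) xi) = symbol mu N alpha xi
       & forall phi : padic p_pr -> R[i], test_function_on N phi ->
           (fun x => vladimirov_on mu N alpha phi x - (lambda p N alpha)%:C * phi x)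
           = fourier_on_inv mu (fun c => P c * fourier_on mu phi c)]).
Proof.
have pin x : (x \in (pball N : set (padic p_pr))) = (x \in padic_ball p_pr N).
  by apply/idP/idP => [/set_mem|h]; last exact/mem_set.
have rin f x : x \in padic_ball p_pr N -> restrict0 N f x = f x :> R[i].
  by move=> xN; rewrite /restrict0 /patch pin xN.
have rout f x : x \notin padic_ball p_pr N -> restrict0 N f x = 0 :> R[i].
  by move=> xN; rewrite /restrict0 /patch pin (negbTE xN).
have trig (phi : padic p_pr -> R[i]) : test_function_on N phi ->
    exists K (d : 'I_(p ^ K) -> R[i]), trig_on N d phi.
  move=> /test_function_onP[_ [K phiK]].
  by have [d dphi] := trig_on_ex phiK; exists K, d.
have vladE phi K (d : 'I_(p ^ K) -> R[i]) : test_function_on N phi ->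
    trig_on N d phi ->
    trig_on N (fun k => d k * (vlad_eig alpha N (dual_rep p_pr N K k))%:C)
      (vladimirov_on mu N alpha phi).
  move=> tphi dphi x xN; rewrite /vladimirov_on rin//.
  apply: (vladimirov_trig mu_haar alpha_gt0 _ dphi xN) => y.
  exact: test_function_on_out.
have diffE phi x : test_function_on N phi -> x \in padic_ball p_pr N ->
    vladimirov_on mu N alpha phi x =
    (lambda p N alpha)%:C * phi x + (vlad_const p alpha)%:C *
      cintegral mu (pball N) (fun y =>
        (pabs R y `^ (- alpha - 1))%:C * (phi (x - y) - phi x)).
  move=> tphi xN; have [K [d dphi]] := trig _ tphi.
  by rewrite (vladE _ _ _ tphi dphi)// (cintegral_diff_trig mu_haar alpha_gt0 dphi xN).
split.
  move=> phi tphi; have [K [d dphi]] := trig _ tphi; split.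
  - by apply: trig_on_test (vladE _ _ _ tphi dphi) => x xN; exact: rout.
  - apply/funext => x; have [xN|xN] := boolP (x \in padic_ball p_pr N).
      (* The distribution is applied to y -> phi (x - y), whose value at 0 is phi x; (i) is then
         (ii) with the factors of the integrand exchanged. *)
      rewrite diffE// /convolution rin// /f_distr subr0.
      congr (_ + _ * _); apply: eq_cintegral => y _; exact: mulrC.
    by rewrite /convolution /vladimirov_on !rout.
  - by move=> x xN; exact: diffE.
have symbol_coset xi eta : xi - eta \in padic_ball p_pr (- N) ->
    symbol mu N alpha xi = symbol mu N alpha eta.
  move=> xe; rewrite (symbolE mu_haar alpha_gt0 N xi) (symbolE mu_haar alpha_gt0 N eta).
  by rewrite (vlad_eig_coset alpha xe).
exists (fun c => symbol mu N alpha (repr c)).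
have symbol_pi xi : symbol mu N alpha (repr (\pi_(dual p_pr N) xi)) =
    symbol mu N alpha xi.
  by apply: symbol_coset; exact: dual_repr_pi.
split=> [|//|phi tphi].
  split=> [xi _|Q QP]; first exact: symbol_pi.
  (* The prescribed points reach every coset: 0 represents the trivial one, and any representative
     of another coset lies outside B_{-N}. *)
  apply/funext => c; have [cN|cN] := boolP (repr c \in padic_ball p_pr (- N)).
    have -> : c = \pi_(dual p_pr N) 0.
      by rewrite -[LHS]reprK; apply: dual_pi_eq; rewrite subr0.
    by rewrite symbol_pi QP//; right.
  by rewrite -{2}[c]reprK QP//; left; exact/negP.
have [K [d dphi]] := trig _ tphi.
have phi0 x : x \notin padic_ball p_pr N -> phi x = 0.
  exact: test_function_on_out.
pose psi x := vladimirov_on mu N alpha phi x - (lambda p N alpha)%:C * phi x.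
pose e k := d k * (vlad_eig alpha N (dual_rep p_pr N K k) - lambda p N alpha)%:C.
have epsi : trig_on N e psi.
  move=> x xN; rewrite /psi (vladE _ _ _ tphi dphi x xN) (dphi x xN) mulr_sumr -sumrB.
  apply: eq_bigr => k _; rewrite /e rmorphB /=.
  by set a := chi _ _; ring.
have tpsi : test_function_on N psi.
  apply: trig_on_test epsi => x xN.
  by rewrite /psi phi0// mulr0 subr0 /vladimirov_on rout.
have fpsi : fourier_on (N := N) mu psi =
    fun c => symbol mu N alpha (repr c) * fourier_on mu phi c.
  apply/funext => c; rewrite (fourier_on_trig mu_haar _ epsi).
  rewrite (fourier_on_trig mu_haar _ dphi) mulr_sumr; apply: eq_bigr => k _.
  case: (boolP (_ \in _)) => [kc|_]; last by rewrite !mulr0.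
  rewrite !mulr1 /e mulrC; congr (_ * _).
  (* The transform at c retains frequency xi_k only when repr c lies in -xi_k + B_{-N}; evenness and
     coset invariance then equate the two eigenvalues. *)
  rewrite (symbolE mu_haar alpha_gt0) -(vlad_eigN alpha N (dual_rep p_pr N K k)).
  have rc : repr c - - dual_rep p_pr N K k \in padic_ball p_pr (- N).
    by rewrite opprK addrC.
  by rewrite (vlad_eig_coset alpha rc).
rewrite -/psi; symmetry; apply: xget_unique; first by split.
by move=> u [tu fu]; apply: (fourier_on_inj mu_haar tu tpsi); rewrite fu.
Qed.
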